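(* Let $G$ be a $\Delta$-regular bipartite graph ($\Delta \ge 1$) with $n$ nodes in each of its two partitions, and let $A$ be its $n\times n$ 0-1 biadjacency matrix, so that all row and column sums of $A$ equal $\Delta$. Then the expected running time needed by the algorithm ''Generate Random Perfect Matching'' (described in the context) to obtain a sample, i.e. a perfect matching of $G$ distributed exactly uniformly over the set of all perfect matchings of $G$, is $$O\left(n^{1.5}\, \Delta^{.5\, n/\Delta}\, 5.3^{\,n/\Delta}\right).$$ In particular, if $\Delta = \gamma n$ for some constant $\gamma$, then the expected running time is $$O\left(n^{1.5 + .5/\gamma}\right).$$
   Context: A bipartite graph with partitions of size $n$ each is identified with the $n\times n$ 0-1 matrix $A$ in which $A(i,j)=1$ if and only if the $i$th node of one partition is adjacent to the $j$th node of the other. A perfect matching (a set of edges such that every node lies in exactly one of them) corresponds to a permutation $\pi$ of $\{1,\dots,n\}$ with $A(\pi(j),j)=1$ for all $j$. Define $g$ on nonnegative integers by $g(0):=0$, $g(1):=e$, and $g(a+1) := g(a) + 1 + \frac{1}{2g(a)} + \frac{0.6}{g(a)^2}$ for $a\ge 1$. For an $n\times n$ 0-1 matrix $A$ with row sums $r(1),\dots,r(n)$ let $\tilde M(A) := \prod_{i=1}^n \frac{g(r(i))}{e}$. For indices $i,j$ with $A(i,j)=1$, let $f(A,i,j)$ be the matrix obtained from $A$ by setting all entries of row $i$ and of column $j$ to $0$, except the entry in position $(i,j)$, which remains $1$. Algorithm ''Generate Random Perfect Matching''. Input: an $n\times n$ 0-1 matrix $A$. Repeat the following pass, with fresh randomness,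 until it ends with ACCEPT = TRUE, then output $\pi$. Pass: set ACCEPT to TRUE and $\tilde A := A$. For $j=1,\dots,n$: let $\tilde r(i)$ be the row sums of $\tilde A$. If $\tilde r(i)=0$ for some $i$, or there exist $i\ne i'$ with $\tilde A(i,j)=\tilde A(i',j)=\tilde r(i)=\tilde r(i')=1$, set ACCEPT to FALSE. Otherwise choose $R\in\{1,\dots,n+1\}$ at random with $P(R=i) = \tilde M(f(\tilde A,i,j))/\tilde M(\tilde A)$ if $1\le i\le n$ and $\tilde A(i,j)=1$, $P(R=i)=0$ if $1\le i\le n$ and $\tilde A(i,j)=0$, and $P(R=n+1)=1-\sum_{i=1}^n P(R=i)$; if $R\le n$, set $\pi(j):=R$ and replace $\tilde A$ by $f(\tilde A,R,j)$; if $R=n+1$, set ACCEPT to FALSE. Running time counts elementary operations, where arithmetic operations on the numbers involved have unit cost and choosing $R$ from a given distribution on $\{1,\dots,n+1\}$ takes $O(n)$ time. Implied constants are absolute in the first bound and may depend on $\gamma$ in the second. *)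

(* Defs.v *)
From Stdlib Require Import String.
From mathcomp Require Import all_boot all_order all_algebra perm.
From mathcomp Require Import all_classical all_reals all_analysis.

Set Implicit Arguments.
Unset Strict Implicit.
Unset Printing Implicit Defensive.
Import Order.TTheory GRing.Theory Num.Theory.
Local Open Scope ring_scope.

(* Three layers: the algorithm as a random process ([passE]); an imperative
   language whose semantics counts elementary operations ([expect]); an
   implementation of the algorithm in that language ([generate]).  A bipartite
   graph is given by its biadjacency matrix, and indices start from 0. *)

Definition rowsum n (A : 'M[bool]_n) (i : 'I_n) : nat :=
  (\sum_(j < n) A i j)%N.

Definition colsum n (A : 'M[bool]_n) (j : 'I_n) : nat :=
  (\sum_(i < n) A i j)%N.

Definition regular (D n : nat) (A : 'M[bool]_n) : Prop :=
  (forall i, rowsum A i = D) /\ (forall j, colsum A j = D).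

Definition perfect_matchings n (A : 'M[bool]_n) : {set 'S_n} :=
  [set pi : 'S_n | [forall j, A (pi j) j]].

Fixpoint g (R : realType) (a : nat) : R :=
  match a with
  | 0 => 0
  | b.+1 => if b is 0 then expR 1
            else g R b + 1 + 1 / (2 * g R b) + (6 / 10) / (g R b) ^+ 2
  end.

Definition Mt (R : realType) n (A : 'M[bool]_n) : R :=
  \prod_(i < n) (g R (rowsum A i) / expR 1).

Definition reduce n (A : 'M[bool]_n) (i j : 'I_n) : 'M[bool]_n :=
  \matrix_(k, l) (if (k == i) && (l == j) then true
                  else if (k == i) || (l == j) then false
                  else A k l).

Definition is_dist (R : realType) (T : finType) (p : T -> R) : bool :=
  [forall t, 0 <= p t] && (\sum_t p t == 1).

(* Expectation of [F] at a point drawn from [p]; drawing from something that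
   is not a probability distribution is an error, which is given the value
   [err]. *)
Definition draw (R : realType) (T : finType) (err : \bar R) (p : T -> R)
    (F : T -> \bar R) : \bar R :=
  if is_dist p then (\sum_(t : T) (p t)%:E * F t)%E else err.

(* The law of the random row chosen for column [j]; [None] stands for the
   outcome n+1. *)
Definition row_law (R : realType) n (A : 'M[bool]_n) (j : 'I_n)
    (o : option 'I_n) : R :=
  let p i := if A i j then Mt R (reduce A i j) / Mt R A else 0 in
  if o is Some i then p i else 1 - \sum_(i < n) p i.

Definition hopeless n (A : 'M[bool]_n) (j : 'I_n) : bool :=
  [exists i, rowsum A i == 0%N] ||
  [exists i, exists i', [&& i != i', A i j, A i' j,
                            rowsum A i == 1%N & rowsum A i' == 1%N]].

Record pass_state (n : nat) := PassState {
  cur : 'M[bool]_n;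
  accept : bool;
  match_of : {ffun 'I_n -> option 'I_n}
}.

(* [columnE j F st] is the expectation of [F] at the state reached from [st] by
   treating column [j]. *)
Definition columnE (R : realType) n (j : 'I_n) (F : pass_state n -> \bar R)
    (st : pass_state n) : \bar R :=
  let failed := PassState (cur st) false (match_of st) in
  if hopeless (cur st) j then F failed
  else draw 0%E (@row_law R n (cur st) j) (fun o =>
    if o is Some i then
      F (PassState (reduce (cur st) i j) (accept st)
           [ffun l => if l == j then Some i else match_of st l])
    else F failed).

(* The outcome of a pass is [None] when it ends with ACCEPT = FALSE. *)
Definition pass_outcome n (st : pass_state n) :
    option {ffun 'I_n -> option 'I_n} :=
  if accept st then Some (match_of st) else None.

Definition passE (R : realType) n (A : 'M[bool]_n)
    (F : option {ffun 'I_n -> option 'I_n} -> \bar R) : \bar R :=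
  foldr (@columnE R n) (F \o @pass_outcome n) (enum 'I_n)
    (PassState A true [ffun=> None]).

(* A memory consists of named two-dimensional arrays of naturals and of reals;
   vectors and scalars use index 0 for the missing coordinates. *)
Record memory (R : realType) := Mem {
  nm : string -> nat -> nat -> nat;
  rm : string -> nat -> nat -> R
}.

Definition upd (T : Type) (h : string -> nat -> nat -> T) (x : string)
    (i k : nat) (v : T) : string -> nat -> nat -> T :=
  fun y a b => if [&& String.eqb y x, a == i & b == k] then v else h y a b.

Definition nset (R : realType) (s : memory R) x i k v : memory R :=
  Mem (upd (nm s) x i k v) (rm s).
Definition rset (R : realType) (s : memory R) x i k v : memory R :=
  Mem (nm s) (upd (rm s) x i k v).

(* [NSize] is the size n of the instance, which programs can read only. *)
Inductive nexp : Type :=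
| NC of nat
| NSize
| NVar of string & nexp & nexp
| NAdd of nexp & nexp
| NSub of nexp & nexp.

Inductive rexp (R : realType) : Type :=
| RC of R
| RVar of string & nexp & nexp
| RAdd of rexp R & rexp R
| RSub of rexp R & rexp R
| RMul of rexp R & rexp R
| RDiv of rexp R & rexp R.

Inductive bexp : Type :=
| BEq of nexp & nexp
| BLt of nexp & nexp
| BAnd of bexp & bexp.

(* [For x e c] runs [c] with x = 0, ..., e - 1; [Draw x p e] stores in x an
   index k < e drawn with probability p[k]; [Repeat c b] runs [c] until [b]. *)
Inductive cmd (R : realType) : Type :=
| Skip
| NSet of string & nexp & nexp & nexp
| RSet of string & nexp & nexp & rexp R
| Seq of cmd R & cmd R
| If of bexp & cmd R & cmd R
| For of string & nexp & cmd R
| Draw of string & string & nexp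
| Repeat of cmd R & bexp.
Arguments Skip {R}.
Arguments NSet {R}.
Arguments For {R}.
Arguments Draw {R}.
Arguments RVar {R}.

Fixpoint neval (R : realType) (n : nat) (e : nexp) (s : memory R) : nat :=
  match e with
  | NC k => k
  | NSize => n
  | NVar x i k => nm s x (neval n i s) (neval n k s)
  | NAdd a b => (neval n a s + neval n b s)%N
  | NSub a b => (neval n a s - neval n b s)%N
  end.

Fixpoint reval (R : realType) (n : nat) (e : rexp R) (s : memory R) : R :=
  match e with
  | RC c => c
  | RVar x i k => rm s x (neval n i s) (neval n k s)
  | RAdd a b => reval n a s + reval n b s
  | RSub a b => reval n a s - reval n b s
  | RMul a b => reval n a s * reval n b s
  | RDiv a b => reval n a s / reval n b s
  end.

Fixpoint beval (R : realType) (n : nat) (e : bexp) (s : memory R) : bool :=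
  match e with
  | BEq a b => neval n a s == neval n b s
  | BLt a b => (neval n a s < neval n b s)%N
  | BAnd a b => beval n a s && beval n b s
  end.

Fixpoint ncost (e : nexp) : nat :=
  match e with
  | NC _ | NSize => 1
  | NVar _ a b | NAdd a b | NSub a b => (1 + ncost a + ncost b)%N
  end.

Fixpoint rcost (R : realType) (e : rexp R) : nat :=
  match e with
  | RC _ => 1
  | RVar _ a b => (1 + ncost a + ncost b)%N
  | RAdd a b | RSub a b | RMul a b | RDiv a b => (1 + rcost a + rcost b)%N
  end.

Fixpoint bcost (e : bexp) : nat :=
  match e with
  | BEq a b | BLt a b => (1 + ncost a + ncost b)%N
  | BAnd a b => (1 + bcost a + bcost b)%N
  end.

Definition tick (R : realType) (timed : bool) (k : nat) : \bar R :=
  if timed then k%:R%:E else 0%E.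

(* [expect timed n c f s]: the expectation of [f] at the final memory of [c]
   started in [s] on an instance of size [n], runs that do not terminate
   contributing 0 to it; if [timed], plus the expected number of elementary
   operations of [c].  Every node of an expression and every command costs one
   operation, and a draw among e outcomes costs e more.  Drawing from an array
   that does not hold a probability distribution counts as running forever.
   The value of a loop is the limit over k of the contributions of its first k
   iterations. *)
Fixpoint expect (R : realType) (timed : bool) (n : nat) (c : cmd R)
    (f : memory R -> \bar R) (s : memory R) : \bar R :=
  let t := tick R timed in
  match c with
  | Skip => (t 1%N + f s)%E
  | NSet x i k e =>
      (t (1 + ncost i + ncost k + ncost e)%N +
       f (nset s x (neval n i s) (neval n k s) (neval n e s)))%E
  | RSet x i k e =>
      (t (1 + ncost i + ncost k + rcost e)%N +
       f (rset s x (neval n i s) (neval n k s) (reval n e s)))%E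
  | Seq c1 c2 => (t 1%N + expect timed n c1 (expect timed n c2 f) s)%E
  | If b c1 c2 =>
      (t (1 + bcost b)%N +
       if beval n b s then expect timed n c1 f s else expect timed n c2 f s)%E
  | For x e c1 =>
      (t (1 + ncost e)%N +
       foldr (fun i F s' => t 1%N + expect timed n c1 F (nset s' x 0 0 i))
             f (iota 0 (neval n e s)) s)%E
  | Draw x p e =>
      let m := neval n e s in
      (t (1 + ncost e + m)%N +
       draw (if timed then +oo else 0)
            (fun k : 'I_m => rm s p k 0)
            (fun k : 'I_m => f (nset s x 0 0 k)))%E
  | Repeat c1 b =>
      ereal_sup (range (fun k : nat =>
        iter k (fun X s1 =>
          expect timed n c1 (fun s' =>
            (t (1 + bcost b)%N + if beval n b s' then f s' else X s')%E) s1)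
        (cst 0%E) s))
  end.

Definition expected_time (R : realType) (n : nat) (c : cmd R) (s : memory R) :
    \bar R :=
  expect true n c (cst 0%E) s.

Definition prob (R : realType) (n : nat) (c : cmd R) (Q : pred (memory R))
    (s : memory R) : \bar R :=
  expect false n c (fun s' => if Q s' then 1%E else 0%E) s.

Declare Scope prog_scope.
Delimit Scope prog_scope with prog.
Notation "c1 ;; c2" := (Seq c1 c2)
  (at level 90, right associativity, only parsing) : prog_scope.

Definition nv (x : string) : nexp := NVar x (NC 0) (NC 0).
Definition nv1 (x : string) (i : nexp) : nexp := NVar x i (NC 0).
Definition rv1 (R : realType) (x : string) (i : nexp) : rexp R := RVar x i (NC 0).
Definition nset0 (R : realType) (x : string) (e : nexp) : cmd R :=
  NSet x (NC 0) (NC 0) e.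
Definition nset1 (R : realType) (x : string) (i e : nexp) : cmd R :=
  NSet x i (NC 0) e.
Definition rset1 (R : realType) (x : string) (i : nexp) (e : rexp R) : cmd R :=
  RSet x i (NC 0) e.

Local Open Scope string_scope.
Local Open Scope prog_scope.

Definition init_pass (R : realType) : cmd R :=
  let i := nv "i" in let k := nv "k" in let a := nv "a" in
  nset0 R "accept" (NC 1) ;;
  For "i" NSize (
    nset1 R "r" i (NC 0) ;;
    For "k" NSize (
      NSet "At" i k (NVar "A" i k) ;;
      nset1 R "r" i (NAdd (nv1 "r" i) (NVar "At" i k)))) ;;
  rset1 "g" (NC 0) (RC 0) ;;
  rset1 "g" (NC 1) (RC (expR 1)) ;;
  For "a" NSize (
    If (BEq a (NC 0)) Skip
      (let ga := rv1 R "g" a in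
       rset1 "g" (NAdd a (NC 1))
         (RAdd (RAdd (RAdd ga (RC 1)) (RDiv (RC 1) (RMul (RC 2) ga)))
               (RDiv (RDiv (RC 6) (RC 10)) (RMul ga ga))))).

Definition check_column (R : realType) : cmd R :=
  let i := nv "i" in let j := nv "j" in
  nset0 R "bad" (NC 0) ;;
  nset0 R "single" (NC 0) ;;
  For "i" NSize (
    If (BEq (nv1 "r" i) (NC 0)) (nset0 R "bad" (NC 1)) Skip ;;
    If (BAnd (BEq (NVar "At" i j) (NC 1)) (BEq (nv1 "r" i) (NC 1)))
      (If (BEq (nv "single") (NC 1))
         (nset0 R "bad" (NC 1))
         (nset0 R "single" (NC 1)))
      Skip).

(* Choosing row i multiplies [Mt] by g(1) / g(r(i)) and, for each other row i'
   with a 1 in column j, by q(i') = g(r(i') - 1) / g(r(i')).  The products of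
   the q(i') over i' < i and over i' > i are tabulated in L[i] and U[i + 1], so
   that all n probabilities take O(n) operations. *)
Definition column_law (R : realType) : cmd R :=
  let i := nv "i" in let j := nv "j" in
  let i1 := NAdd i (NC 1) in
  let down := NSub NSize i1 in
  let gr := rv1 R "g" (nv1 "r" i) in
  For "i" NSize (
    If (BEq (NVar "At" i j) (NC 1))
      (rset1 "q" i (RDiv (rv1 R "g" (NSub (nv1 "r" i) (NC 1))) gr))
      (rset1 "q" i (RC 1))) ;;
  rset1 "L" (NC 0) (RC 1) ;;
  For "i" NSize (
    rset1 "L" i1 (RMul (rv1 R "L" i) (rv1 R "q" i))) ;;
  rset1 "U" NSize (RC 1) ;;
  For "i" NSize (
    rset1 "U" down (RMul (rv1 R "q" down) (rv1 R "U" (NAdd down (NC 1))))) ;;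
  rset1 "p" NSize (RC 1) ;;
  For "i" NSize (
    If (BEq (NVar "At" i j) (NC 1))
      (rset1 "p" i (RMul (RDiv (rv1 R "g" (NC 1)) gr)
                         (RMul (rv1 R "L" i) (rv1 R "U" i1))))
      (rset1 "p" i (RC 0)) ;;
    rset1 "p" NSize (RSub (rv1 R "p" NSize) (rv1 R "p" i))).

Definition select_row (R : realType) : cmd R :=
  let i := nv "i" in let j := nv "j" in let row := nv "R" in
  nset1 R "pi" j row ;;
  For "i" NSize (
    If (BEq (NVar "At" i j) (NC 1))
      (NSet "At" i j (NC 0) ;;
       nset1 R "r" i (NSub (nv1 "r" i) (NC 1)))
      Skip) ;;
  For "i" NSize (NSet "At" row i (NC 0)) ;;
  NSet "At" row j (NC 1) ;;
  nset1 R "r" row (NC 1).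

Definition pass (R : realType) : cmd R :=
  init_pass R ;;
  For "j" NSize (
    check_column R ;;
    If (BEq (nv "bad") (NC 1))
      (nset0 R "accept" (NC 0))
      (column_law R ;;
       Draw "R" "p" (NAdd NSize (NC 1)) ;;
       If (BLt (nv "R") NSize)
         (select_row R)
         (nset0 R "accept" (NC 0)))).

Definition generate (R : realType) : cmd R :=
  Repeat (pass R) (BEq (nv "accept") (NC 1)).

Definition input (R : realType) n (A : 'M[bool]_n) (s : memory R) : Prop :=
  forall i j : 'I_n, nm s "A" i j = A i j.

Definition output (R : realType) n (s : memory R) : {ffun 'I_n -> option 'I_n} :=
  [ffun j : 'I_n => insub (nm s "pi" j 0)].

Definition outcome (R : realType) n (s : memory R) :
    option {ffun 'I_n -> option 'I_n} :=
  if nm s "accept" 0 0 == 1%N then Some (output n s) else None.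

Local Close Scope prog_scope.
Local Close Scope string_scope.

Definition outputs (R : realType) n (pi : 'S_n) : pred (memory R) :=
  fun s => output n s == [ffun j => Some (pi j)].

Definition pass_implemented (R : realType) n (A : 'M[bool]_n) (s : memory R) :
    Prop :=
  forall F : option {ffun 'I_n -> option 'I_n} -> \bar R,
    (forall o, 0 <= F o)%E ->
    expect false n (pass R) (F \o @outcome R n) s = passE A F.

Definition uniform_output (R : realType) n (A : 'M[bool]_n) (s : memory R) :
    Prop :=
  (forall pi, pi \in perfect_matchings A ->
     prob n (generate R) (@outputs R n pi) s =
       ((#|perfect_matchings A|%:R)^-1)%:E) /\
  prob n (generate R)
    (fun s' => [exists pi in perfect_matchings A, @outputs R n pi s']) s = 1%E.

(* Main.v *)
(* A pass draws row i with probability Mt(f(At,i,j)) / Mt(At), so the ratios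
   telescope: each perfect matching comes out with probability 1 / Mt(A), and
   the accepted one is uniform.  That these are sub-probabilities amounts, with
   the y_i the 1 / g(r(i) - 1), to e Y <= exp Y for Y = sum y_i, because
   g(a + 1) / g(a) >= exp (1 / g(a)).

   The expected number of passes is Mt(A) / per(A).  For a D-regular A the
   numerator is (g(D) / e)^n, where g(D) <= D + ln(D)/2 + ln 5.3 for D >= 2, and
   van der Waerden's bound per(A) >= n! (D/n)^n with Stirling's formula bounds
   the ratio by a constant times D^(n/(2D)) 5.3^(n/D) / sqrt n; a pass takes
   O(n^2) operations.

   Van der Waerden's bound is proved by Gurvits' method.  Write W_S(v) for the
   permanent of A with the columns outside S replaced by v.  If A has positive
   entries, W_S does not vanish where all Re v_i > 0: the polynomial
   y |-> W_S(v + y a_c) has its roots in Re y < 0, hence a nonzero derivative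
   at 0, and this derivative is a multiple of W_(S + c)(v).  By homogeneity
   W_S(v + y a_c) is then real-rooted in y for v > 0, so AM-GM over its roots
   compares its derivative at 0 with its values, and going from S empty to S
   full yields the product of the ((k-1)/k)^(k-1). *)
From Stdlib Require Import String.
Require Import Defs.
From mathcomp Require Import all_boot all_order all_algebra perm.
From mathcomp Require Import all_classical all_reals all_analysis.
From mathcomp Require Import algC ring lra zify.
Import Order.TTheory GRing.Theory Num.Theory.
Import numFieldNormedType.Exports.
Local Open Scope ring_scope.

Set Implicit Arguments.
Unset Strict Implicit.
Unset Printing Implicit Defensive.

(** * The permanent of a regular matrix *)

Section VanDerWaerden.
Import mathcomp.boot.finset.

(* W_S(v) of the header. *)
Definition mixper (K : comNzRingType) n (a : 'I_n -> 'I_n -> K) (S : {set 'I_n})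
    (v : 'I_n -> K) : K :=
  \sum_(s : 'S_n) \prod_(j < n) (if j \in S then a (s j) j else v (s j)).

Section Mixper.
Variables (K : comNzRingType) (n : nat).
Implicit Types (a : 'I_n -> 'I_n -> K) (S : {set 'I_n}) (v : 'I_n -> K).

Lemma eq_mixper a S v w : v =1 w -> mixper a S v = mixper a S w.
Proof.
by move=> vw; apply: eq_bigr => s _; apply: eq_bigr => j _; rewrite vw.
Qed.

Lemma mixper0 a v : mixper a set0 v = n`!%:R * \prod_i v i.
Proof.
transitivity (\sum_(s in {: 'S_n}) \prod_i v i).
  apply: eq_bigr => s _.
  rewrite [RHS](reindex_inj (@perm_inj _ s)) /=.
  by apply: eq_bigr => j _; rewrite inE.
by rewrite sumr_const card_Sn mulr_natl.
Qed.

Lemma mixperT a v : mixper a setT v = \sum_(s : 'S_n) \prod_j a (s j) j.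
Proof. by apply: eq_bigr => s _; apply: eq_bigr => j _; rewrite inE. Qed.

Lemma mixperZ a S v l :
  mixper a S (fun i => l * v i) = l ^+ #|~: S| * mixper a S v.
Proof.
rewrite /mixper mulr_sumr; apply: eq_bigr => s _.
rewrite (bigID [in S]) [in RHS](bigID [in S]) /= mulrCA; congr (_ * _).
  by apply: eq_bigr => j ->.
have <- : \prod_(j | j \notin S) l = l ^+ #|~: S|.
  by rewrite -prodr_const; apply: eq_bigl => j; rewrite inE.
by rewrite -big_split /=; apply: eq_bigr => j /negPf ->.
Qed.

(** The restriction of [mixper a S] to the line through [v] in the direction of column [c]. As a
    [mixper] over [{poly K}] it gives access to roots and coefficients. *)
Definition mixpoly a S v c : {poly K} :=
  mixper (fun i j => (a i j)%:P) S (fun i => (v i)%:P + (a i c)%:P * 'X).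

Lemma horner_mixpoly a S v c y :
  (mixpoly a S v c).[y] = mixper a S (fun i => v i + y * a i c).
Proof.
rewrite /mixpoly /mixper horner_sum; apply: eq_bigr => s _.
rewrite horner_prod; apply: eq_bigr => j _.
by case: ifP => _; rewrite !hornerE // mulrC.
Qed.

Lemma coef1_prod (I : eqType) (r : seq I) (p : I -> {poly K}) : uniq r ->
  (\prod_(i <- r) p i)`_1 =
  \sum_(i <- r) (p i)`_1 * \prod_(k <- r | k != i) (p k)`_0.
Proof.
elim: r => [|x r IH] /=; first by rewrite !big_nil coef1.
case/andP=> xr ur.
have c0 (q : {poly K}) s : (\prod_(i <- s) p i)`_0 = \prod_(i <- s) (p i)`_0.
  by rewrite -horner_coef0 horner_prod; apply: eq_bigr => k _; rewrite horner_coef0.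
rewrite !big_cons coefM !big_ord_recl big_ord0 /= /bump /= addr0 subnn.
rewrite addrC; congr (_ + _).
  rewrite eqxx /= (c0 0); congr (_ * _).
  rewrite big_seq [RHS]big_seq_cond; apply: eq_bigl => k.
  by case kr: (k \in r) => //=; apply/esym; apply: contraNneq xr => <-.
rewrite IH // mulr_sumr; apply: eq_big_seq => k kr.
rewrite big_cons mulrCA; case: eqP => [xk|//].
by rewrite xk kr in xr.
Qed.

(** By the product rule, the derivative at 0 is a sum over the columns [j] outside [S], where column
    [j] becomes [a_c]. Transposing [j] and [c] makes every term the same mixed permanent, whence the
    factor [#|~: S|]. *)
Lemma coef1_mixpoly a S v c : c \notin S ->
  (mixpoly a S v c)`_1 = #|~: S|%:R * mixper a (c |: S) v.
Proof.
move=> cS; rewrite /mixpoly /mixper coef_sum.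
under eq_bigr => s _ do rewrite coef1_prod ?index_enum_uniq //.
rewrite exchange_big /= (bigID [in S]) /= big1 ?add0r; last first.
  by move=> j jS; rewrite big1 // => s _; rewrite jS coefC /= mul0r.
transitivity (\sum_(j in ~: S) mixper a (c |: S) v); last first.
  by rewrite sumr_const mulr_natl.
apply: eq_big => [j|j jS]; first by rewrite inE.
rewrite (reindex_inj (mulgI (tperm j c))) /=; apply: eq_bigr => s _.
rewrite permM tpermL (negPf jS) coefD coefC coefMX coefC /= add0r.
rewrite [RHS](bigD1 c) //= setU11; congr (_ * _).
rewrite (reindex_inj (@perm_inj _ (tperm j c))) /=.
apply: eq_big => [k|k].
  by rewrite -(inj_eq (@perm_inj _ (tperm j c)) k c) tpermR.
move=> kj; rewrite permM tpermK !inE.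
have kc : k != c by apply: contraNneq kj => ->; rewrite tpermR.
rewrite (negPf kc) /=.
have -> : (tperm j c k \in S) = (k \in S).
  case: tpermP => // [->|->]; by rewrite (negPf jS) (negPf cS).
case: ifP => kS; last by rewrite coefD coefC coefMX addr0.
rewrite coefC /= tpermD // eq_sym; first by apply: contraTneq kS => ->.
by apply: contraTneq kS => ->.
Qed.

End Mixper.

Section Linear.
Variable C : numClosedFieldType.

Lemma coef1_prod_lin (bs : seq C) :
  (\prod_(b <- bs) (1 + b%:P * 'X))`_1 = \sum_(b <- bs) b.
Proof.
have c0 s : (\prod_(b <- s) (1 + b%:P * 'X))`_0 = 1 :> C.
  rewrite -horner_coef0 horner_prod big1 // => b _.
  by rewrite !hornerE.
elim: bs => [|b s IH]; first by rewrite !big_nil coef1.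
rewrite !big_cons coefM !big_ord_recl big_ord0 /= /bump /= addr0 subnn c0 IH.
by rewrite !coefD !coefC !coefMX !coefC /= !addr0 add0r mul1r mulr1 addrC.
Qed.

(** Since 0 is not a root, each root [z] is traded for [b = - z^-1] and its factor becomes
    [1 + b X]. In this normalization the logarithmic derivative at 0 is the sum of the [b]. *)
Lemma poly_lin_factor (p : {poly C}) : p.[0] != 0 ->
  exists bs : seq C, [/\ size bs = (size p).-1,
    p = p.[0] *: \prod_(b <- bs) (1 + b%:P * 'X)
    & forall b, b \in bs -> b != 0 /\ p.[- b^-1] = 0].
Proof.
move=> p0; have [rs Ep] := closed_field_poly_normal p.
have pn0 : p != 0 by apply: contraNneq p0 => ->; rewrite horner0.
have rn0 z : z \in rs -> z != 0.
  move=> zr; apply: contraNneq p0 => z0.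
  rewrite Ep hornerZ horner_prod (big_rem z) //= hornerXsubC z0 subrr.
  by rewrite mul0r mulr0.
exists [seq - z^-1 | z <- rs]; split.
- rewrite size_map; move/(congr1 (fun q : {poly C} => size q)): Ep.
  by rewrite size_scale ?lead_coef_eq0 // size_prod_XsubC => ->.
- rewrite {2}Ep hornerZ horner_prod -scalerA {1}Ep; congr (_ *: _).
  rewrite big_map; elim: (rs) rn0 => [|z s IH] rn0.
    by rewrite !big_nil scale1r.
  rewrite !big_cons IH; last by move=> y ys; rewrite rn0 // inE ys orbT.
  have z0 : z != 0 by rewrite rn0 // mem_head.
  rewrite hornerXsubC -scalerAr [(0 - z) * _]mulrC -scalerA; congr (_ *: _).
  rewrite scalerAl; congr (_ * _).
  rewrite sub0r -mul_polyC mulrDr mulr1 mulrA -polyCM mulrNN divff // mul1r.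
  by rewrite polyCN addrC.
move=> b /mapP[z zr ->]; have z0 := rn0 _ zr; split.
  by rewrite oppr_eq0 invr_eq0.
rewrite invrN invrK opprK Ep hornerZ horner_prod (big_rem z) //= hornerXsubC.
by rewrite subrr mul0r mulr0.
Qed.

Lemma prod_lin_AGM (bs : seq C) (t : C) : 0 <= t ->
  (forall b, b \in bs -> 0 <= b) ->
  \prod_(b <- bs) (1 + b * t) <=
    (1 + (\sum_(b <- bs) b) * t / (size bs)%:R) ^+ size bs.
Proof.
move=> t0 b0; case: (posnP (size bs)) => [/size0nil ->|sz].
  by rewrite big_nil expr0.
have := @leif_AGM C 'I_(size bs) predT (fun i => 1 + bs`_i * t).
rewrite (big_nth 0) big_mkord [\sum_(b <- bs) _](big_nth 0) big_mkord.
rewrite cardT size_enum_ord => -[i _|].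
  by rewrite addr_ge0 // mulr_ge0 // b0 // mem_nth.
have -> : (\sum_(i < size bs) (1 + bs`_i * t)) / (size bs)%:R
   = 1 + (\sum_(i < size bs) bs`_i) * t / (size bs)%:R.
  rewrite big_split /= sumr_const card_ord mulrDl divff ?pnatr_eq0 -?lt0n //.
  by rewrite -mulr_suml.
by move=> le _; apply: le.
Qed.

(** If [w] were not real, some [l] with ['Re l = 1] would carry it onto the imaginary axis; once it
    is real, [l = 1] gives its sign. *)
Lemma rotate_lt0 (w : C) :
  (forall l : C, 0 < 'Re l -> 'Re (l * w) < 0) -> w < 0.
Proof.
move=> H; have wr : 'Im w = 0.
  apply/eqP/negPn/negP => w0.
  have ar : 'Re w / 'Im w \is Num.real by rewrite rpred_div ?Creal_Re ?Creal_Im.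
  have := H (1 + 'i * ('Re w / 'Im w)).
  rewrite ReM Re_rect ?Im_rect ?rpred1 // divfK // mul1r subrr ltxx => H1.
  by have := H1 ltr01.
have := H 1; rewrite (Creal_ReP 1 _) ?rpred1 // mul1r => /(_ ltr01).
by rewrite {2}[w]Crect wr mulr0 addr0.
Qed.

Lemma ReV_sign (b : C) : b != 0 -> ('Re b <= 0) -> 0 <= 'Re (- b^-1).
Proof.
move=> b0 bR; rewrite raddfN /= oppr_ge0.
have -> : b^-1 = b^* / `|b| ^+ 2 by rewrite normCK invfM mulrCA divff ?mulr1 // conjC_eq0.
rewrite ReMr ?rpredV ?rpredX ?normr_real // Re_conj.
by rewrite pmulr_lle0 // invr_gt0 exprn_gt0 // normr_gt0.
Qed.

(** * Stability and capacity of mixed permanents *)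

Section Stable.
Variables (n : nat) (a : 'I_n -> 'I_n -> C).
Hypothesis a0 : forall i j, 0 < a i j.
Implicit Types (S : {set 'I_n}) (v : 'I_n -> C).

Lemma mixper_gt0 S v : (forall i, 0 < v i) -> 0 < mixper a S v.
Proof.
move=> v0; rewrite /mixper (bigD1 (1%g : {perm 'I_n})) //= ltr_pwDl //.
  by apply: prodr_gt0 => j _; case: ifP.
by apply: sumr_ge0 => s _; apply: prodr_ge0 => j _; case: ifP => _; apply: ltW.
Qed.

(** Every permutation contributes a polynomial of this degree with positive leading coefficient, so
    nothing cancels in the sum. *)
Lemma size_mixpoly S v c : size (mixpoly a S v c) = #|~: S|.+1.
Proof.
pose p (s : 'S_n) := \prod_j
  (if j \in S then (a (s j) j)%:P else (v (s j))%:P + (a (s j) c)%:P * 'X).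
have szp i : size ((v i)%:P + (a i c)%:P * 'X) = 2%N.
  by rewrite addrC size_MXaddC polyC_eq0 (gt_eqF (a0 _ _)) /=
    size_polyC (gt_eqF (a0 _ _)).
have sp s : size (p s) = #|~: S|.+1.
  rewrite size_prod => [|j _]; last first.
    by case: ifP => _; rewrite -size_poly_eq0 ?szp // size_polyC (gt_eqF (a0 _ _)).
  rewrite (bigID [in S]) /= (eq_bigr (fun=> 1%N)) => [|j ->]; last first.
    by rewrite size_polyC (gt_eqF (a0 _ _)).
  rewrite sum1_card (eq_bigr (fun=> 2%N)) => [|j /negPf ->//].
  rewrite (eq_bigl [in ~: S]) => [|j]; last by rewrite inE.
  rewrite sum_nat_const; have := cardsC S; rewrite card_ord => E.
  have aux (x y z : nat) : (x + y = z)%N -> ((x + y * 2).+1 - z = y.+1)%N by lia.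
  exact: aux E.
have cp s : 0 < (p s)`_#|~: S|.
  have -> : (p s)`_#|~: S| = lead_coef (p s) by rewrite lead_coefE sp.
  rewrite lead_coef_prod; apply: prodr_gt0 => j _.
  case: ifP => _; first by rewrite lead_coefC.
  rewrite lead_coefE szp coefD coefC coefMX coefC add0r //=.
apply/eqP; rewrite eqn_leq; apply/andP; split.
  by apply: leq_trans (size_sum _ _ _) _; apply/bigmax_leqP => s _; rewrite sp.
rewrite ltnNge; apply/negP => /leq_sizeP /(_ _ (leqnn _)) /eqP.
rewrite coef_sum gt_eqF // (bigD1 (1%g : {perm 'I_n})) //= ltr_pwDl //.
  exact: cp.
by apply: sumr_ge0 => s _; apply/ltW/cp.
Qed.

(* [y |-> mixper a S (v + y a_c)] has all its roots in the open left
   half-plane, so that its derivative at 0 does not vanish. *)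
Lemma mixper_neq0 S v : (forall i, 0 < 'Re (v i)) -> mixper a S v != 0.
Proof.
move: {2}#|S| (erefl #|S|) => k; elim: k S v => [|k IH] S v Sk v0.
  move/eqP: Sk; rewrite cards_eq0 => /eqP ->; rewrite mixper0; apply: mulf_neq0.
    by rewrite pnatr_eq0 -lt0n fact_gt0.
  apply/prodf_neq0 => i _; apply: contraTneq (v0 i) => ->.
  by rewrite raddf0 ltxx.
have [c cS] : exists c, c \in S by apply/set0Pn; rewrite -cards_eq0 Sk.
set S' := S :\ c; have ES : c |: S' = S by rewrite setD1K.
have cS' : c \notin S' by rewrite !inE eqxx.
have S'k : #|S'| = k by have := cardsD1 c S; rewrite cS Sk -/S'; lia.
set p := mixpoly a S' v c.
have pn0 y : 0 <= 'Re y -> p.[y] != 0.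
  move=> y0; rewrite horner_mixpoly; apply: IH => // i.
  rewrite raddfD /= ReMr ?gtr0_real //; apply: ltr_pwDl => //.
  by rewrite mulr_ge0 // ltW.
have p0 : p.[0] != 0 by rewrite pn0 // raddf0.
have [bs [sz Ep Hb]] := poly_lin_factor p0.
(* The roots of [p] are the [- b^-1], so by [pn0] every [b] has positive real part, and so has their
   sum, which is [p'(0) / p(0)]. *)
have bs0 : 0 < 'Re (\sum_(b <- bs) b).
  have : (0 < size bs)%N.
    rewrite sz size_mixpoly /= card_gt0; apply/set0Pn; exists c.
    by rewrite inE.
  have {}Hb b : b \in bs -> 0 < 'Re b.
    move=> /Hb[b0 rb]; rewrite real_ltNge ?rpred0 ?Creal_Re //.
    apply/negP => bR; have := pn0 _ (ReV_sign b0 bR).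
    by rewrite rb eqxx.
  case: (bs) Hb => // b s Hb _; rewrite raddf_sum /= big_cons ltr_pwDl ?Hb ?mem_head //.
  rewrite big_seq; apply: sumr_ge0 => x xs; apply/ltW/Hb.
  by rewrite inE xs orbT.
have := coef1_mixpoly a v cS'; rewrite ES -/p => E.
apply: contraTneq bs0 => S0; move: E; rewrite S0 mulr0 Ep coefZ coef1_prod_lin.
move/eqP; rewrite mulf_eq0 (negPf p0) /= => /eqP ->.
by rewrite raddf0 ltxx.
Qed.

(* Homogeneity makes [mixper a S] nonvanishing on every rotation of the
   half-plane, so that [y |-> mixper a S (v + y a_c)] is real-rooted for
   positive [v]. *)
Lemma mixper_AGM S v c t : c \notin S -> (forall i, 0 < v i) -> 0 < t ->
  mixper a S (fun i => v i + t * a i c) <=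
  mixper a S v *
    (1 + mixper a (c |: S) v / mixper a S v * t) ^+ #|~: S|.
Proof.
move=> cS v0 t0; set p := mixpoly a S v c; set k := #|~: S|.
have W0 : 0 < mixper a S v by exact: mixper_gt0.
have pE0 : p.[0] = mixper a S v.
  by rewrite horner_mixpoly; apply: eq_mixper => i; rewrite mul0r addr0.
have p0 : p.[0] != 0 by rewrite pE0 gt_eqF.
have [bs [sz Ep Hb]] := poly_lin_factor p0.
have sbs : size bs = k by rewrite sz size_mixpoly.
have k0 : (0 < k)%N by rewrite card_gt0; apply/set0Pn; exists c; rewrite inE.
have bp b : b \in bs -> 0 < b.
  move=> /Hb[b0 rb]; suff : - b^-1 < 0 by rewrite oppr_lt0 invr_gt0.
  apply: rotate_lt0 => l l0; rewrite real_ltNge ?rpred0 ?Creal_Re //.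
  apply/negP => lb.
  (* If ['Re (l * - b^-1)] were nonnegative, all entries of [l (v - b^-1 a_c)] would have positive
     real part; but by homogeneity [mixper a S] vanishes there, as [p] does at [- b^-1]. *)
  have := @mixper_neq0 S (fun i => l * (v i + - b^-1 * a i c)).
  rewrite mixperZ -horner_mixpoly -/p rb mulr0 eqxx => /(_ _)/negP[] // i.
  rewrite mulrDr raddfD /= ReMr ?gtr0_real // mulrA ReMr ?gtr0_real //.
  apply: ltr_pwDl; first by rewrite mulr_gt0.
  by rewrite mulr_ge0 // ltW.
(* The linear coefficient determines the mean of the [k] numbers [b], which is all that AM-GM
   needs. *)
have sb : p.[0] * \sum_(b <- bs) b = k%:R * mixper a (c |: S) v.
  by rewrite -(coef1_mixpoly a v cS) -/p Ep coefZ coef1_prod_lin -Ep.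
rewrite -horner_mixpoly -/p Ep hornerZ pE0 ler_pM2l // horner_prod.
rewrite (eq_bigr (fun b => 1 + b * t)) => [|b _]; last by rewrite !hornerE.
have := prod_lin_AGM (ltW t0) (fun b bb => ltW (bp b bb)).
rewrite sbs; congr (_ <= (1 + _) ^+ _).
have -> : \sum_(b <- bs) b = k%:R * mixper a (c |: S) v / mixper a S v.
  by rewrite -sb pE0 mulrAC divff ?mul1r // gt_eqF.
by field; rewrite !gt_eqF // ltr0n.
Qed.

(** Induction on [#|S|], starting from the capacity hypothesis at [S] empty. Freezing a column [c]
    removes the variable [x c]: it is given a free value [t > 0] in the previous bound, and the best
    [t] is chosen. The factor [k ^ k], with [0 ^ 0 = 1], records the accumulated loss. *)
Lemma mixper_capacity (N : nat) S x :
  (forall y : 'I_n -> C, (forall j, 0 < y j) ->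
     N%:R ^+ n * \prod_j y j <= \prod_i \sum_j a i j * y j) ->
  (forall j, 0 < x j) ->
  (N ^ n * n`! * #|~: S| ^ #|~: S|)%:R * \prod_(j in ~: S) x j <=
  (n ^ n)%:R * mixper a S (fun i => \sum_(j in ~: S) a i j * x j).
Proof.
move=> cap; move: {2}#|S| (erefl #|S|) => m; elim: m S x => [|m IH] S x Sm x0.
  move/eqP: Sm; rewrite cards_eq0 => /eqP ->; rewrite setC0 cardsT card_ord.
  rewrite mixper0 (eq_bigl xpredT) => [|j]; last by rewrite inE.
  have -> : \prod_i \sum_(j in [set: 'I_n]) a i j * x j =
      \prod_i \sum_j a i j * x j.
    by apply: eq_bigr => i _; apply: eq_bigl => j; rewrite inE.
  rewrite natrM mulrAC mulrC ler_pM2l; last first.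
    by rewrite ltr0n expn_gt0; case: (posnP n).
  rewrite natrM natrX mulrAC mulrC ler_pM2l ?ltr0n ?fact_gt0 //.
  exact: cap.
have [c cS] : exists c, c \in S by apply/set0Pn; rewrite -cards_eq0 Sm.
set S' := S :\ c; have ES : c |: S' = S by rewrite setD1K.
have cS' : c \notin S' by rewrite !inE eqxx.
have S'm : #|S'| = m by have := cardsD1 c S; rewrite cS Sm -/S'; lia.
have CS' : ~: S' = c |: ~: S.
  by apply/setP => j; rewrite !inE negb_and negbK.
have cCS : c \notin ~: S by rewrite inE cS.
set k := #|~: S|; have k' : #|~: S'| = k.+1 by rewrite CS' cardsU1 cCS.
set v := fun i => \sum_(j in ~: S) a i j * x j.
have step t : 0 < t ->
  (N ^ n * n`! * k.+1 ^ k.+1)%:R * (t * \prod_(j in ~: S) x j) <=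
  (n ^ n)%:R * mixper a S' (fun i => v i + t * a i c).
  move=> t0; have := IH S' (fun j => if j == c then t else x j) S'm.
  rewrite k' CS' big_setU1 //= eqxx (eq_bigr x) => [|j jS]; last first.
    by case: eqP => // jc; rewrite -jc jS in cCS.
  have -> : mixper a S' (fun i => \sum_(j in c |: ~: S)
      a i j * (if j == c then t else x j)) =
    mixper a S' (fun i => v i + t * a i c).
    apply: eq_mixper => i; rewrite big_setU1 //= eqxx addrC mulrC.
    congr (_ + _); apply: eq_bigr => j jS.
    by case: eqP => // jc; rewrite -jc jS in cCS.
  by apply=> j; case: ifP.
(* With no variable left, [v] is 0 and the bound for [S'] at [t = 1] is already the claim; the
   optimal [t] used below would divide by [k = 0]. *)
have [k0|k0] := posnP k.
  have CS0 : ~: S = set0 by apply/eqP; rewrite -cards_eq0 -/k k0.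
  have := step 1 ltr01; rewrite k0 CS0 big_set0 !mulr1.
  congr (_ <= _ * _); apply: eq_bigr => s _; apply: eq_bigr => j _.
  have -> : j \in S by rewrite -[S]setCK CS0 setC0 inE.
  rewrite /v CS0 big_set0 add0r mul1r !inE.
  have -> : j \in S by rewrite -[S]setCK CS0 setC0 inE.
  by rewrite andbT; case: eqP => //= ->.
have v0 i : 0 < v i.
  have [d dS] : exists d, d \in ~: S by apply/set0Pn; rewrite -card_gt0.
  rewrite /v (bigD1 d) //= ltr_pwDl ?mulr_gt0 //.
  by apply: sumr_ge0 => j _; rewrite mulr_ge0 // ltW.
set W := mixper a S' v; set W' := mixper a S v.
have W0 : 0 < W by apply: mixper_gt0.
have W'0 : 0 < W' by apply: mixper_gt0.
have kC : 0 < k%:R :> C by rewrite ltr0n.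
(* This value of [t] minimizes [(1 + t W' / W) ^ (k + 1) / t]. *)
have t0 : 0 < W / (W' * k%:R) by rewrite divr_gt0 // mulr_gt0.
have := mixper_AGM cS' v0 t0; rewrite ES -/W -/W' k'.
have -> : 1 + W' / W * (W / (W' * k%:R)) = k.+1%:R / k%:R :> C.
  by rewrite -natr1; field; rewrite !gt_eqF.
set t := W / _ in t0 *; move=> le1.
have := le_trans (step t t0) (ler_wpM2l (ler0n _ _) le1).
set P := \prod_(j in _) _; rewrite natrM -/W -/W'.
have -> : (N ^ n * n`!)%:R * (k.+1 ^ k.+1)%:R * (t * P) =
   ((N ^ n * n`! * k ^ k)%:R * P) * (k.+1%:R ^+ k.+1 * W / (W' * k%:R ^+ k.+1)).
  rewrite /t !natrM !natrX [k%:R ^+ k.+1]exprS.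
  by field; rewrite !gt_eqF // exprn_gt0.
have -> : (n ^ n)%:R * (W * (k.+1%:R / k%:R) ^+ k.+1) =
   (n ^ n)%:R * W' * (k.+1%:R ^+ k.+1 * W / (W' * k%:R ^+ k.+1)).
  by rewrite expr_div_n; field; rewrite !gt_eqF // exprn_gt0.
by rewrite ler_pM2r // divr_gt0 ?mulr_gt0 ?exprn_gt0 ?ltr0n.
Qed.

Lemma van_der_waerden (N : nat) :
  (forall y : 'I_n -> C, (forall j, 0 < y j) ->
     N%:R ^+ n * \prod_j y j <= \prod_i \sum_j a i j * y j) ->
  (N ^ n * n`!)%:R <= (n ^ n)%:R * \sum_(s : 'S_n) \prod_j a (s j) j.
Proof.
move=> cap; have := @mixper_capacity N setT (fun=> 1) cap (fun=> ltr01).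
by rewrite setCT cards0 expn0 muln1 big_set0 mulr1 mixperT.
Qed.

End Stable.
End Linear.

(** Arithmetic and geometric means of the list in which [y j] occurs [m j] times. *)
Lemma AGM_weights (C : numClosedFieldType) n N (m : 'I_n -> nat) (y : 'I_n -> C) :
  (\sum_j m j = N)%N -> (forall j, 0 < y j) ->
  N%:R ^+ N * \prod_j y j ^+ m j <= (\sum_j (m j)%:R * y j) ^+ N.
Proof.
move=> mN y0; pose bs := flatten [seq nseq (m j) (y j) | j <- enum 'I_n].
have pE : \prod_j y j ^+ m j = \prod_(b <- bs) b.
  rewrite big_flatten big_map /= big_enum; apply: eq_bigr => j _ /=.
  by rewrite big_nseq iter_mulr_1.
have sE : \sum_j (m j)%:R * y j = \sum_(b <- bs) b.
  rewrite big_flatten big_map /= big_enum; apply: eq_bigr => j _ /=.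
  by rewrite big_nseq iter_addr_0 mulr_natl.
have szE : size bs = N.
  rewrite size_flatten /shape -map_comp sumnE big_map big_enum -mN.
  by apply: eq_bigr => j _ /=; rewrite size_nseq.
have bp b : b \in bs -> 0 < b.
  by move=> /flatten_mapP[j _]; rewrite mem_nseq => /andP[_ /eqP->].
rewrite pE sE.
have := @leif_AGM C 'I_N predT (fun i => bs`_i).
rewrite (big_nth 0) big_mkord szE [\sum_(b <- bs) _](big_nth 0) big_mkord szE.
rewrite cardT size_enum_ord => -[i _|].
  by rewrite ltW // bp // mem_nth // szE.
move=> le _; have [->|N0] := posnP N; first by rewrite !expr0 big_ord0 mulr1.
rewrite mulrC -ler_pdivlMr ?exprn_gt0 ?ltr0n // -expr_div_n.
exact: le.
Qed.

(** Take [N]-th powers and apply the weighted mean inequality to each row: by the column sums, every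
    [y j] then collects the exponent [N]. *)
Lemma capacity_biregular (C : numClosedFieldType) n N (m : 'I_n -> 'I_n -> nat)
    (y : 'I_n -> C) : (0 < N)%N ->
  (forall i, (\sum_j m i j)%N = N) -> (forall j, (\sum_i m i j)%N = N) ->
  (forall j, 0 < y j) ->
  N%:R ^+ n * \prod_j y j <= \prod_i \sum_j (m i j)%:R * y j.
Proof.
move=> N0 rN cN y0; rewrite -(@ler_pXn2r _ N) ?nnegrE //; first last.
- by apply: prodr_ge0 => i _; apply: sumr_ge0 => j _; rewrite mulr_ge0 // ltW.
- by rewrite mulr_ge0 ?exprn_ge0 // prodr_ge0 // => j _; rewrite ltW.
rewrite exprMn -!prodrXl.
have -> : (N%:R ^+ n) ^+ N * \prod_j y j ^+ N =
    \prod_i (N%:R ^+ N * \prod_j y j ^+ m i j) :> C.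
  rewrite big_split /= prodr_const card_ord -exprM mulnC exprM; congr (_ * _).
  rewrite exchange_big /=; apply: eq_bigr => j _.
  by rewrite prodrXr cN.
apply: ler_prod => i _; rewrite AGM_weights // andbT mulr_ge0 ?exprn_ge0 //.
by rewrite prodr_ge0 // => j _; rewrite exprn_ge0 // ltW.
Qed.

(** The argument on roots takes place in an algebraically closed field; as both sides are naturals,
    the inequality descends from [algC]. *)
Lemma van_der_waerden_nat n N (m : 'I_n -> 'I_n -> nat) :
  (0 < N)%N -> (forall i j, (0 < m i j)%N) ->
  (forall i, (\sum_j m i j)%N = N) -> (forall j, (\sum_i m i j)%N = N) ->
  (N ^ n * n`! <= n ^ n * \sum_(s : 'S_n) \prod_j m (s j) j)%N.
Proof.
move=> N0 m0 rN cN.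
have := @van_der_waerden algC n (fun i j => (m i j)%:R) _ N.
move=> H; rewrite -(ler_nat algC) [X in _ <= X]natrM natr_sum.
under [X in _ <= _ * X]eq_bigr => s _ do rewrite natr_prod.
apply: H => [i j|y y0]; first by rewrite ltr0n.
exact: capacity_biregular.
Qed.

(* The bound for positive matrices, applied to [M A + J] with [M] large. *)
Lemma card_perm_matrix_ge n D (A : 'I_n -> 'I_n -> bool) : (0 < D)%N ->
  (forall i, (\sum_j A i j)%N = D) -> (forall j, (\sum_i A i j)%N = D) ->
  (D ^ n * n`! <= n ^ n * #|[set s : 'S_n | [forall j, A (s j) j]]|)%N.
Proof.
(* [M] is the total error that the permutations other than matchings can cause, up to a common
   factor, so that it stays below [M + 1] in the final comparison. *)
move=> D0 rD cD; set PM := finset _; set P := #|PM|; pose M := (n ^ n * n`!)%N.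
have [n0|n0] := posnP n.
  have -> : (D ^ n * n`! = 1)%N by rewrite n0.
  have -> : (n ^ n = 1)%N by rewrite n0.
  rewrite mul1n /P card_gt0.
  apply/set0Pn; exists 1%g; rewrite inE; apply/forallP => j.
  by case: j => j /= jn; exfalso; rewrite n0 in jn.
have Dn : (D <= n)%N.
  rewrite -(rD (Ordinal n0)) -[n in (_ <= n)%N]card_ord -sum1_card.
  by apply: leq_sum => j _; case: (A _ _).
pose m i j := (M * A i j + 1)%N.
have sumN (F : 'I_n -> bool) :
    (\sum_i F i)%N = D -> (\sum_i (M * F i + 1))%N = (M * D + n)%N.
  by move=> <-; rewrite big_split /= -big_distrr sum1_card card_ord.
have vdw : ((M * D + n) ^ n * n`! <=
    n ^ n * \sum_(s : 'S_n) \prod_j m (s j) j)%N.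
  apply: van_der_waerden_nat => [|i j|i|j];
    [|by rewrite /m addn1|exact: sumN|exact: sumN].
  by rewrite addn_gt0 n0 orbT.
(* A matching contributes at most [(M + 1) ^ n]; any other permutation meets a zero of [A], where
   the entry of [m] is only 1, and loses a factor [M + 1]. *)
have upper : (\sum_(s : 'S_n) \prod_j m (s j) j <=
    P * M.+1 ^ n + n`! * M.+1 ^ n.-1)%N.
  apply: (@leq_trans (\sum_(s : 'S_n)
      ((if s \in PM then M.+1 ^ n else 0) + M.+1 ^ n.-1)))%N; last first.
    rewrite big_split /= -big_mkcond /= sum_nat_const leq_add2l.
    rewrite (eq_bigl [in {: 'S_n}]) // sum_nat_const leq_mul2r.
    by rewrite (card_Sn n) leqnn orbT.
  apply: leq_sum => s _; rewrite inE; case: forallP => [As|nAs].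
    rewrite (leq_trans _ (leq_addr _ _)) // -[n in (_ ^ n)%N]card_ord.
    rewrite -prod_nat_const; apply: leq_prod => j _.
    by rewrite /m; case: (A _ _); lia.
  rewrite add0n; have [j0 Aj0] : exists j, ~~ A (s j) j.
    apply/existsP; rewrite -negb_forall; apply/forallP => H; exact: nAs.
  rewrite (bigD1 j0) //= {1}/m (negPf Aj0) muln0 mul1n.
  have -> : n.-1 = #|predC1 j0| by rewrite cardC1 card_ord.
  rewrite -prod_nat_const; apply: leq_prod => j _.
  by rewrite /m; case: (A _ _); lia.
have lower : (M.+1 ^ n * D ^ n <= (M * D + n) ^ n)%N.
  by rewrite -expnMn leq_exp2r //; lia.
have M1 : (M.+1 ^ n = M.+1 * M.+1 ^ n.-1)%N by rewrite -expnS prednK.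
set Q := (M.+1 ^ n.-1)%N in M1 upper; have Q0 : (0 < Q)%N by rewrite expn_gt0.
have : (M.+1 * Q * (D ^ n * n`!) <= n ^ n * (P * (M.+1 * Q) + n`! * Q))%N.
  rewrite -M1 mulnA.
  apply: leq_trans (leq_mul lower (leqnn _)) _.
  by apply: leq_trans vdw _; rewrite leq_mul2l upper orbT.
have -> : (n ^ n * (P * (M.+1 * Q) + n`! * Q) =
          Q * (M.+1 * (n ^ n * P) + M))%N by rewrite /M; ring.
rewrite [(M.+1 * Q)%N]mulnC -mulnA leq_pmul2l // => H.
(* In [H] two multiples of [M + 1] are compared up to an excess of [M], which is too small to
   reverse the order of the integer cofactors. *)
rewrite leqNgt; apply/negP => H1.
have : (M.+1 * (n ^ n * P).+1 <= M.+1 * (D ^ n * n`!))%N by rewrite leq_mul2l H1 orbT.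
by rewrite mulnS; lia.
Qed.

End VanDerWaerden.

(** * Exponential, Stirling and [g] estimates *)

Section Analysis.
Variable R : realType.
Implicit Types x y : R.

(** The derivative of [p e^-z + q] is [(p' - p) e^-z + q'], so by the mean value theorem an
    inequality between an exponential and polynomials reduces to a sign condition. *)
Lemma poly_expRN_nondecreasing (p q : {poly R}) x : 0 <= x ->
  (forall z, 0 <= z <= x -> 0 <= (p^`() - p).[z] * expR (- z) + q^`().[z]) ->
  p.[0] + q.[0] <= p.[x] * expR (- x) + q.[x].
Proof.
move=> x0 df0.
pose f : R -> R := horner p * (expR \o -%R) + horner q.
pose df z : R := (p^`() - p).[z] * expR (- z) + q^`().[z].
have fdf z : is_derive z (1 : R) f (df z).
  apply: is_derive_eq; rewrite /df hornerD hornerN /= /GRing.scale /=.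
  ring.
have cf : ({within `[0, x], continuous f})%classic.
  apply: derivable_within_continuous => z _.
  by have [] := fdf z.
have [c] := MVT_segment x0 (fun z _ => fdf z) cf.
rewrite in_itv /= => /df0 dc0 E.
have : 0 <= f x - f 0 by rewrite E mulr_ge0 // subr0.
have fE z : f z = p.[z] * expR (- z) + q.[z] by [].
by rewrite subr_ge0 !fE oppr0 expR0 mulr1.
Qed.

(** Here [p' - p = z^2 (13/10 - 6/10 z)], which is nonnegative up to [z = 13/6]. The coefficient
    6/10 is that of the recursion of [g]. *)
Lemma expR_le_cubic x : 0 <= x <= 2 ->
  expR x <= 1 + x + x ^+ 2 / 2 + 6 / 10 * x ^+ 3.
Proof.
move=> /andP[x0 x2].
pose p : {poly R} := 1 + 'X + (2^-1)%:P * 'X^2 + (6 / 10)%:P * 'X^3.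
have pE z : p.[z] = 1 + z + z ^+ 2 / 2 + 6 / 10 * z ^+ 3.
  by rewrite /p !hornerE /=; field.
have dpE z : (p^`() - p).[z] = 13 / 10 * z ^+ 2 - 6 / 10 * z ^+ 3.
  by rewrite /p !poly.derivE !hornerE /=; field.
rewrite -[expR x]invrK -expRN -[leLHS]mul1r ler_pdivrMr ?expR_gt0 //.
have := @poly_expRN_nondecreasing p 0 x x0.
rewrite !pE !horner0 !addr0 expr0n /= mul0r expr0n /= mulr0 !addr0; apply.
move=> z /andP[z0 zx]; rewrite deriv0 horner0 addr0 dpE.
rewrite mulr_ge0 ?expR_ge0 //.
have z2 := le_trans zx x2.
have : 0 <= z ^+ 2 * (13 / 10 - 6 / 10 * z) by rewrite mulr_ge0 ?sqr_ge0 //; lra.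
by rewrite (_ : z ^+ 2 * _ = 13 / 10 * z ^+ 2 - 6 / 10 * z ^+ 3) //; ring.
Qed.

Lemma expR_ge_quadratic x : 0 <= x -> 1 + x + x ^+ 2 / 2 <= expR x.
Proof.
move=> x0.
pose p : {poly R} := - (1 + 'X + (2^-1)%:P * 'X^2).
have pE z : p.[z] = - (1 + z + z ^+ 2 / 2).
  by rewrite /p !hornerE /=; field.
have dpE z : (p^`() - p).[z] = z ^+ 2 / 2.
  by rewrite /p !poly.derivE !hornerE /=; field.
rewrite -[expR x]invrK -expRN -[leRHS]mul1r ler_pdivlMr ?expR_gt0 //.
have := @poly_expRN_nondecreasing p 0 x x0.
rewrite !pE !horner0 !addr0 expr0n /= mul0r !addr0 mulNr lerN2; apply.
move=> z /andP[z0 zx]; rewrite deriv0 horner0 addr0 dpE.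
by rewrite mulr_ge0 ?expR_ge0 // divr_ge0 ?sqr_ge0.
Qed.

(** The Pade approximant [(2 + x) / (2 - x)], stated without division so as to hold for all
    [x >= 0]. *)
Lemma expR_pade x : 0 <= x -> (2 - x) * expR x <= 2 + x.
Proof.
move=> x0.
rewrite -[expR x]invrK -expRN ler_pdivrMr ?expR_gt0 //.
have := @poly_expRN_nondecreasing ('X + 2%:P) ('X - 2%:P) x x0.
rewrite !hornerE /= => H.
have {}H : 2 + 0 - 2 <= (x + 1 + 1) * expR (- x) + x - 2.
  apply: H => z /andP[z0 zx]; rewrite !poly.derivE !hornerE /=.
  have : 0 <= (expR z - (1 + z)) * expR (- z).
    by rewrite mulr_ge0 ?expR_ge0 // subr_ge0 expR_ge1Dx.
  rewrite mulrBl expRxMexpNx_1; lra.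
lra.
Qed.

(** The trapezoid bound for the integral of [1 / x] over [[n, n + 1]]. With [u = 1 / n] and
    [s = ln (1 + u)] it amounts to [2 s (1 + u) <= (1 + u)^2 - 1]. *)
Lemma ln_succ_le (n : nat) : (0 < n)%N ->
  ln (n.+1%:R : R) - ln n%:R <= (2 * n%:R + 1) / (2 * n%:R * (n%:R + 1)).
Proof.
move=> n0; have n0R : 0 < n%:R :> R by rewrite ltr0n.
set s := ln _ - _.
have Es : expR s = 1 + n%:R^-1.
  by rewrite /s expRB !lnK ?posrE // -natr1 mulrDl divff ?gt_eqF // mul1r.
have s0 : 0 <= s.
  by rewrite subr_ge0 ler_ln ?posrE ?ltr0n // ler_nat.
have := expR_ge_quadratic s0; rewrite Es => H.
set P := 1 + s + _ in H.
have P0 : 0 < P by rewrite /P; nra.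
have V : n%:R * n%:R^-1 = 1 :> R by rewrite divff // gt_eqF.
have V0 : 0 < n%:R^-1 :> R by rewrite invr_gt0.
rewrite ler_pdivlMr; last by nra.
set u : R := n%:R^-1 in H V V0.
have : 2 * s * (1 + u) <= u * (2 + u).
  (* [y^2 - 2 s y] does not decrease from [y = P] to [y = 1 + u], and at [P] it exceeds 1 by exactly
     [s^4 / 4]. *)
  have : 0 <= (1 + u - P) * (1 + u + P - 2 * s).
    rewrite mulr_ge0 ?subr_ge0 // /P; have := sqr_ge0 s; move: H; rewrite /P; lra.
  have : 0 <= P ^+ 2 - 1 - 2 * s * P.
    have -> : P ^+ 2 - 1 - 2 * s * P = s ^+ 4 / 4 by rewrite /P; field.
    by rewrite divr_ge0 ?exprn_ge0.
  by clearbody P; lra.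
set N : R := n%:R in n0R V *.
nra.
Qed.

(** The midpoint value of [1 / x] on [[n, n + 1]]. At [s = 2 / (2 n + 1)] the quotient
    [(2 + s) / (2 - s)] is exactly [(n + 1) / n]. *)
Lemma ln_succ_ge (n : nat) : (0 < n)%N ->
  2 / (2 * n%:R + 1) <= ln (n.+1%:R : R) - ln n%:R.
Proof.
move=> n0; have n0R : 0 < n%:R :> R by rewrite ltr0n.
set s := _ / _.
have s0 : 0 <= s by rewrite divr_ge0 // addr_ge0 // mulr_ge0.
have sE : s * (2 * n%:R + 1) = 2 by rewrite divfK // gt_eqF //; lra.
rewrite -ln_div ?posrE ?ltr0n // -[s]expRK ler_ln ?posrE ?expR_gt0 ?divr_gt0 ?ltr0n //.
rewrite ler_pdivlMr // -natr1.
have := expR_pade s0.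
have : 0 < expR s by exact: expR_gt0.
set N : R := n%:R in n0R sE *.
nra.
Qed.

(** Stirling's lower bound, with [3 / 4] in place of the sharp constant [ln (2 pi) / 2]. *)
Lemma ln_fact_ge (n : nat) : (0 < n)%N ->
  3 / 4 + ln n%:R / 2 + n%:R * ln n%:R - n%:R <= ln (n`!%:R : R).
Proof.
move=> n0.
(* The added [1 / (4 n)] makes the case [n = 1] an equality and telescopes: the trapezoid bound
   loses exactly [1 / (4 N (N + 1))] per step. *)
suff : 3 / 4 + (4 * n%:R)^-1 + ln n%:R / 2 + n%:R * ln n%:R - n%:R
    <= ln (n`!%:R : R).
  have : 0 < (4 * n%:R)^-1 :> R by rewrite invr_gt0 mulr_gt0 // ltr0n.
  lra.
case: n n0 => // n _; elim: n => [|n IH].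
  rewrite (_ : 1`! = 1%N) // ln1; lra.
rewrite factS natrM lnM ?posrE ?ltr0n ?fact_gt0 //.
have := ln_succ_le (ltn0Sn n); set N : R := n.+1%:R in IH *.
have N0 : 0 < N by rewrite ltr0n.
have -> : n.+2%:R = N + 1 by rewrite /N natr1.
set d := ln (N + 1) - ln N => dle.
have -> : ln (N + 1) = ln N + d by rewrite /d; lra.
have : (N + 1 / 2) * d <= 1 + (4 * N)^-1 - (4 * (N + 1))^-1.
  apply: (@le_trans _ _ ((N + 1 / 2) * ((2 * N + 1) / (2 * N * (N + 1))))).
    by rewrite ler_pM2l //; lra.
  rewrite le_eqVlt; apply/orP; left; apply/eqP; field; rewrite !gt_eqF //; lra.
clearbody d N.
lra.
Qed.

(** * Growth of [g] and the number of passes *)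

Let e : R := expR 1.

(** Here and for [e_le], the elementary bounds are taken at [1 / 5] and raised to the fifth power;
    at 1 they would only give 2.5 and 3. *)
Lemma e_ge : 27 / 10 <= e.
Proof.
have := @expR_ge_quadratic (1 / 5) _; rewrite /e.
have -> : expR 1 = expR (1 / 5) ^+ 5 :> R by rewrite -expRM_natr; congr expR; field.
have -> : 0 <= 1 / 5 :> R by lra.
move=> /(_ isT) H; apply: (@le_trans _ _ ((122 / 100) ^+ 5)).
  by rewrite -subr_ge0; lra.
by rewrite lerXn2r ?nnegrE ?expR_ge0 //; lra.
Qed.

Lemma e_le : e <= 273 / 100.
Proof.
have := @expR_pade (1 / 5) _; rewrite /e.
have -> : expR 1 = expR (1 / 5) ^+ 5 :> R by rewrite -expRM_natr; congr expR; field.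
have -> : 0 <= 1 / 5 :> R by lra.
move=> /(_ isT) H; apply: (@le_trans _ _ ((11 / 9) ^+ 5)).
  by rewrite lerXn2r ?nnegrE ?expR_ge0 //; lra.
by rewrite -subr_ge0; lra.
Qed.

Lemma g1E : g R 1 = e. Proof. by []. Qed.

Lemma gSE a : (0 < a)%N ->
  g R a.+1 = g R a + 1 + 1 / (2 * g R a) + 6 / 10 / g R a ^+ 2.
Proof. by case: a. Qed.

Lemma g_ge a : (0 < a)%N -> a%:R + 17 / 10 <= g R a.
Proof.
case: a => // a _; elim: a => [|a IH]; first by have := e_ge; rewrite /e /=; lra.
have g0 : 0 < g R a.+1 by apply: lt_le_trans IH; rewrite ltr_wpDl.
rewrite gSE // -[a.+2%:R]natr1.
have : 0 <= 1 / (2 * g R a.+1) by rewrite divr_ge0 // mulr_ge0 // ltW.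
have : 0 <= 6 / 10 / g R a.+1 ^+ 2 by rewrite divr_ge0 ?sqr_ge0 //; lra.
lra.
Qed.

Lemma g_gt0 a : (0 < a)%N -> 0 < g R a.
Proof. by move=> a0; apply: lt_le_trans (g_ge a0); rewrite ltr_wpDl. Qed.

Lemma g_ge0 a : 0 <= g R a.
Proof. by case: a => // a; rewrite ltW // g_gt0. Qed.

Lemma g_succ a : g R a <= g R a.+1.
Proof.
case: a => [|a]; first exact: g_ge0.
have g0 := g_gt0 (ltn0Sn a); rewrite [leRHS]gSE //.
have : 0 <= 1 / (2 * g R a.+1) by rewrite divr_ge0 // mulr_ge0 // ltW.
have : 0 <= 6 / 10 / g R a.+1 ^+ 2 by rewrite divr_ge0 ?sqr_ge0 //; lra.
lra.
Qed.

Lemma g_ge_e a : (0 < a)%N -> e <= g R a.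
Proof.
case: a => // a _; elim: a => [|a IH]; first by [].
exact: le_trans IH (g_succ _).
Qed.

(** For [u = 1 / g a] the recursion says that the ratio is [1 + u + u^2 / 2 + 6/10 u^3]: the
    definition of [g] is made for the cubic bound on the exponential. *)
Lemma g_ratio a : (0 < a)%N -> expR (g R a)^-1 <= g R a.+1 / g R a.
Proof.
move=> a0; have g0 := g_gt0 a0.
have -> : g R a.+1 / g R a =
    1 + (g R a)^-1 + (g R a)^-1 ^+ 2 / 2 + 6 / 10 * (g R a)^-1 ^+ 3.
  by rewrite gSE //; field; rewrite gt_eqF.
apply: expR_le_cubic; rewrite invr_ge0 ltW //=.
rewrite invf_ple ?posrE //.
by have := g_ge_e a0; have := e_ge; lra.
Qed.

(** The increment of [g] beyond 1 is compared with half that of the logarithm. The start [a = 2]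
    rests on [g 2 <= 4] and [e^4 <= 2 * 5.3^2]; at [a = 1] the bound is false, as
    [e > 1 + ln 5.3]. *)
Lemma g_le a : (1 < a)%N -> g R a <= a%:R + ln a%:R / 2 + ln (53 / 10).
Proof.
case: a => // -[|a] // _; elim: a => [|a IH].
  have e0 : 0 < e by rewrite expR_gt0.
  have ie : e^-1 <= 10 / 27.
    by rewrite invf_ple ?posrE //; have := e_ge; lra.
  have ie0 : 0 <= e^-1 by rewrite invr_ge0 ltW.
  have g2 : g R 2 <= 4.
    rewrite gSE // g1E.
    have -> : 1 / (2 * e) = e^-1 / 2 by field; rewrite gt_eqF.
    have -> : 6 / 10 / e ^+ 2 = 6 / 10 * (e^-1 * e^-1) by field; rewrite gt_eqF.
    have : e^-1 * e^-1 <= 10 / 27 * (10 / 27) by apply: ler_pM.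
    have := e_le; lra.
  have : 4 <= ln 2 + 2 * ln (53 / 10) :> R.
    have -> : 2 * ln (53 / 10) = ln ((53 / 10) ^+ 2) :> R by rewrite lnXn ?mulr_natl //; lra.
    rewrite -lnM ?posrE ?exprn_gt0 //; try lra.
    rewrite -[4]expRK ler_ln ?posrE ?expR_gt0 ?mulr_gt0 ?exprn_gt0 //; try lra.
    have -> : expR 4 = e ^+ 4 :> R by rewrite /e -expRM_natr mul1r.
    apply: (@le_trans _ _ ((273 / 100) ^+ 4)).
      by rewrite lerXn2r ?nnegrE ?expR_ge0 ?e_le //; lra.
    by rewrite -subr_ge0; lra.
  lra.
have := ln_succ_ge (ltn0Sn a.+1); set N : R := a.+2%:R in IH *.
have gN : N + 17 / 10 <= g R a.+2 by exact: g_ge.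
have N0 : 0 < N by rewrite ltr0n.
rewrite [a.+3%:R](_ : _ = N + 1) ?natr1 // => H.
rewrite gSE //.
(* By [ln_succ_ge], [1 / (2 N + 1)] is at most half the increment of the logarithm. With
   [G = g (a + 2) >= N + 17/10] one has [2 N + 1 <= 2 (G - 12/10)], and
   [(G + 12/10) (G - 12/10) <= G^2]. *)
suff : 1 / (2 * g R a.+2) + 6 / 10 / g R a.+2 ^+ 2 <= 1 / (2 * N + 1) by lra.
set G := g R a.+2 in gN *.
have G0 : 0 < G by lra.
have -> : 1 / (2 * G) + 6 / 10 / G ^+ 2 = (G + 12 / 10) / (2 * G ^+ 2).
  by field; rewrite gt_eqF.
rewrite ler_pdivrMr ?mulr_gt0 ?exprn_gt0 // mulrAC ler_pdivlMr; last by lra.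
nra.
Qed.

(** By [ln (1 + x) <= x] the left side is at most [g D - D], to which [g_le] applies; for [D = 1]
    the claim is [e <= 5.3]. *)
Lemma g_pow_le D : (0 < D)%N ->
  D%:R * ln (g R D / D%:R) <= ln D%:R / 2 + ln (53 / 10).
Proof.
move=> D0; have D0R : 0 < D%:R :> R by rewrite ltr0n.
case: D D0 D0R => // -[|D] _ D0R.
  rewrite g1E divr1 mul1r ln1 mul0r add0r ler_ln ?posrE ?expR_gt0 //.
  by have := e_le; lra.
have gl := @g_le D.+2 isT.
have := @le_ln1Dx R (g R D.+2 / D.+2%:R - 1) _.
have -> : -1 < g R D.+2 / D.+2%:R - 1.
  by rewrite ltrBrDl subrr divr_gt0 // g_gt0.
rewrite subrKC -(ler_pM2l D0R) mulrBr mulr1 mulrCA divff ?gt_eqF // mulr1.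
move=> /(_ isT) H; lra.
Qed.

Lemma lnXn_mul n x : 0 < x -> ln (x ^+ n) = n%:R * ln x.
Proof. by move=> x0; rewrite lnXn // mulr_natl. Qed.

(** The quotient bounds the expected number of passes and [n^2] stands for the cost of one. In
    logarithms, Stirling's bound cancels [n ln n] and [n], and leaves [- ln n / 2] to be combined
    with [2 ln n]. *)
Lemma passes_le n D : (0 < n)%N -> (0 < D)%N ->
  n%:R ^+ 2 * ((g R D / e) ^+ n * n%:R ^+ n / (D%:R ^+ n * n`!%:R)) <=
  n%:R `^ (3 / 2) * D%:R `^ (1 / 2 * (n%:R / D%:R)) * (53 / 10) `^ (n%:R / D%:R).
Proof.
move=> n0 D0; have n0R : 0 < n%:R :> R by rewrite ltr0n.
have D0R : 0 < D%:R :> R by rewrite ltr0n.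
have g0 := g_gt0 D0; have e0 : 0 < e by rewrite expR_gt0.
have f0 : 0 < n`!%:R :> R by rewrite ltr0n fact_gt0.
have p0 : 0 < 53 / 10 :> R by lra.
rewrite -ler_ln ?posrE; first last.
- by rewrite !mulr_gt0 ?powR_gt0.
- by rewrite !mulr_gt0 ?divr_gt0 ?invr_gt0 ?mulr_gt0 ?exprn_gt0 // divr_gt0.
rewrite !lnM ?posrE ?mulr_gt0 ?powR_gt0 ?invr_gt0 ?mulr_gt0 ?exprn_gt0 ?divr_gt0 //.
rewrite lnV ?posrE ?mulr_gt0 ?exprn_gt0 // lnM ?posrE ?exprn_gt0 //.
rewrite !lnXn_mul ?divr_gt0 // !ln_powR ln_div ?posrE // /e expRK.
have := ln_fact_ge n0; have := g_pow_le D0.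
rewrite ln_div ?posrE // => H1 H2.
have H3 : n%:R * (ln (g R D) - ln D%:R) <=
    n%:R / D%:R * (ln D%:R / 2 + ln (53 / 10)).
  rewrite -[leLHS](_ : n%:R / D%:R * (D%:R * (ln (g R D) - ln D%:R)) = _).
    by rewrite ler_pM2l // divr_gt0.
  by field; rewrite gt_eqF.
set q := n%:R / D%:R in H3 *.
lra.
Qed.

End Analysis.

(** * The law of a pass *)

Section Process.
Variable R : realType.
Implicit Types n : nat.

Lemma big_option (T : finType) (F : option T -> R) :
  \sum_o F o = F None + \sum_i F (Some i).
Proof.
rewrite (bigD1 None) //=; congr (_ + _).
rewrite (reindex_omap (Some : T -> option T) id) => [|[x|]] //.
by apply: eq_bigl => x; rewrite eqxx.
Qed.

Lemma draw_EFin (T : finType) (p h : T -> R) (err : \bar R) : is_dist p ->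
  draw err p (fun t => (h t)%:E) = (\sum_t p t * h t)%:E.
Proof.
by move=> pd; rewrite /draw pd -sumEFin; apply: eq_bigr => t _; rewrite EFinM.
Qed.

Section Matrix.
Variable n : nat.
Implicit Types (B : 'M[bool]_n) (i j k : 'I_n) (pi : 'S_n).

Lemma rowsum_gt0 B i j : B i j -> (0 < rowsum B i)%N.
Proof. by move=> B_ij; rewrite /rowsum (bigD1 j) //= B_ij. Qed.

Lemma rowsum_reduce B i j k : B i j ->
  rowsum (reduce B i j) k = if k == i then 1%N else (rowsum B k - B k j)%N.
Proof.
move=> B_ij; rewrite /rowsum (bigD1 j) //= [in RHS](bigD1 j) //= addKn !mxE eqxx andbT orbT.
case: eqP => [->|/eqP ki] /=.
  by rewrite big1 // => l lj; rewrite mxE eqxx (negPf lj).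
by rewrite add0n; apply: eq_bigr => l lj; rewrite mxE (negPf ki) (negPf lj).
Qed.

(** The factor that row [k] contributes to the change of [Mt] when another row is matched to column
    [j]. *)
Definition col_ratio B j k : R :=
  if B k j then g R (rowsum B k - 1) / g R (rowsum B k) else 1.

Lemma Mt_reduce B i j : B i j -> (forall k, 0 < rowsum B k)%N ->
  Mt R (reduce B i j) / Mt R B =
  g R 1 / g R (rowsum B i) * \prod_(k | k != i) col_ratio B j k.
Proof.
move=> B_ij r0; rewrite /Mt -prodf_div (bigD1 i) //= rowsum_reduce // eqxx /=.
have e0 : expR 1 != 0 :> R by rewrite gt_eqF ?expR_gt0.
have gn0 k : g R (rowsum B k) != 0 by rewrite gt_eqF ?g_gt0.
congr (_ * _); first by field; rewrite e0 gn0.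
apply: eq_bigr => k ki; rewrite rowsum_reduce // (negPf ki) /col_ratio.
by case: (B k j); rewrite ?subn0; field; rewrite e0 gn0.
Qed.

Lemma Mt_gt0 B : (forall k, 0 < rowsum B k)%N -> 0 < Mt R B.
Proof.
by move=> r0; apply: prodr_gt0 => k _; rewrite divr_gt0 ?expR_gt0 ?g_gt0.
Qed.

Lemma Mt_ge0 B : 0 <= Mt R B.
Proof. by apply: prodr_ge0 => k _; rewrite divr_ge0 ?expR_ge0 ?g_ge0. Qed.

Lemma hopelessPn B j : ~~ hopeless B j ->
  (forall k, 0 < rowsum B k)%N /\
  (forall i k, i != k -> B i j -> B k j -> rowsum B i = 1%N -> (1 < rowsum B k)%N).
Proof.
rewrite negb_or => /andP[/existsPn h0 /existsPn h1].
have r0 k : (0 < rowsum B k)%N by rewrite lt0n h0.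
split=> // i k ik Bi Bk ri; rewrite ltn_neqAle r0 andbT eq_sym.
apply/negP => /eqP rk; have /existsPn /(_ k) := h1 i.
by rewrite ik Bi Bk ri rk.
Qed.

Lemma col_ratio_ge0 B j k : 0 <= col_ratio B j k.
Proof. by rewrite /col_ratio; case: ifP => // _; rewrite divr_ge0 ?g_ge0. Qed.

Lemma col_ratio_le1 B j k : (0 < rowsum B k)%N -> col_ratio B j k <= 1.
Proof.
rewrite /col_ratio; case: ifP => // _; case: (rowsum B k) => // r _.
by rewrite subn1 ler_pdivrMr ?g_gt0 // mul1r g_succ.
Qed.

(* When every row meeting column [j] has at least two ones, this is
   [e Y <= exp Y] for [Y] the sum of the [1 / g (r i - 1)]; a row with a single
   one leaves only one term. *)
Lemma sum_col_ratio_le1 B j : ~~ hopeless B j ->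
  \sum_(i | B i j) g R 1 / g R (rowsum B i) * \prod_(k | k != i) col_ratio B j k
    <= 1.
Proof.
move=> /hopelessPn[r0 r1].
have pr0 i : 0 <= \prod_(k | k != i) col_ratio B j k.
  by apply: prodr_ge0 => k _; apply: col_ratio_ge0.
have [/existsP[i /andP[Bi /eqP ri]]|/existsPn r2] :=
    boolP [exists i, B i j && (rowsum B i == 1%N)].
  rewrite (bigD1 i) //= [X in _ + X]big1 ?addr0.
    rewrite ri divff ?gt_eqF ?g_gt0 // mul1r.
    by apply: prodr_ile1 => k _; rewrite col_ratio_ge0 col_ratio_le1.
  move=> k /andP[Bk ki].
  (* As [g 0 = 0], the row [i] with a single one puts a factor 0 into every other term. *)
  by rewrite (bigD1 i) 1?eq_sym //= /col_ratio Bi ri subnn /= mul0r mul0r mulr0.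
have {}r2 i : B i j -> (1 < rowsum B i)%N.
  move=> Bi; rewrite ltn_neqAle r0 andbT eq_sym.
  by have := r2 i; rewrite Bi.
pose y i : R := (g R (rowsum B i).-1)^-1.
pose Y := \sum_(i | B i j) y i.
have qy i : B i j -> 0 < col_ratio B j i /\ col_ratio B j i <= expR (- y i).
  move=> Bi; rewrite /col_ratio Bi subn1; have := r2 _ Bi.
  rewrite /y; case: (rowsum B i) => // -[//|r] _ /=.
  have g1 : 0 < g R r.+1 by rewrite g_gt0.
  have g2 : 0 < g R r.+2 by rewrite g_gt0.
  split; first by rewrite divr_gt0.
  rewrite expRN -[leLHS]invrK lef_pV2 ?posrE ?expR_gt0 ?invr_gt0 ?divr_gt0 //.
  by rewrite invf_div; apply: (@g_ratio R r.+1).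
(* Since [g 1 = e] and [1 / g (r i) = y i * col_ratio B j i], the factor missing from each product
   is restored. *)
have -> : \sum_(i | B i j) g R 1 / g R (rowsum B i) *
       \prod_(k | k != i) col_ratio B j k =
    expR 1 * Y * \prod_k col_ratio B j k.
  rewrite mulrAC mulr_sumr; apply: eq_bigr => i Bi.
  rewrite [in RHS](bigD1 i) //=; set P := \prod_(k < n | k != i) _.
  rewrite /col_ratio Bi /y subn1; have := r2 _ Bi.
  case: (rowsum B i) => // -[//|r] _; rewrite [r.+2.-1]/=.
  have g1 : 0 < g R r.+1 by rewrite g_gt0.
  have g2 : 0 < g R r.+2 by rewrite g_gt0.
  by field; rewrite !gt_eqF.
have Y0 : 0 <= Y by apply: sumr_ge0 => i _; rewrite invr_ge0 g_ge0.
apply: (@le_trans _ _ (expR 1 * Y * expR (- Y))).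
  apply: ler_wpM2l; first by rewrite mulr_ge0 ?expR_ge0.
  rewrite /Y -sumrN expR_sum (bigID (fun k => B k j)) /=.
  rewrite [X in _ * X]big1 ?mulr1 => [|k /negPf Bk]; last by rewrite /col_ratio Bk.
  by apply: ler_prod => k Bk; have [/ltW -> ->] := qy k Bk.
rewrite expRN ler_pdivrMr ?expR_gt0 // mul1r mulrC -ler_pdivlMr ?expR_gt0 // -expRB.
by have := expR_ge1Dx (Y - 1); lra.
Qed.

(** The probabilities sum to 1 by the definition of the outcome [None], whose own probability is
    nonnegative by [sum_col_ratio_le1]. *)
Lemma row_law_dist B j : ~~ hopeless B j -> is_dist (@row_law R n B j).
Proof.
move=> hB; have [r0 _] := hopelessPn hB.
apply/andP; split; last by rewrite big_option /row_law subrK.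
apply/forallP => -[i|] /=.
  by case: ifP => // _; rewrite divr_ge0 ?Mt_ge0.
rewrite subr_ge0; apply: le_trans (sum_col_ratio_le1 hB).
rewrite [leRHS]big_mkcond /=; apply: ler_sum => i _.
by case: ifP => // B_ij; rewrite Mt_reduce.
Qed.

Lemma perfect_matching_reduce B i j pi : B i j ->
  (pi \in perfect_matchings (reduce B i j)) =
  (pi \in perfect_matchings B) && (pi j == i).
Proof.
move=> B_ij; rewrite !inE; apply/forallP/andP => [H|[/forallP H /eqP pij] l].
  have pij : pi j == i by have := H j; rewrite mxE eqxx andbT orbT; case: eqP.
  split=> //; apply/forallP => l; have := H l; rewrite mxE.
  case: eqP => [pl|_] /=; case: eqP => //= lj _.
  by rewrite pl lj.
rewrite mxE -pij (inj_eq perm_inj) andbb orbb.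
by case: eqP.
Qed.

(** A row with a single one must be matched there, so two such rows would compete for column [j]. *)
Lemma hopeless_no_matching B j : hopeless B j -> perfect_matchings B = finset.set0.
Proof.
move=> hB; apply/setP => pi; rewrite !inE; apply/negP => /forallP H.
have Hr i : B i (pi^-1%g i) by have := H (pi^-1%g i); rewrite permKV.
have one i l : rowsum B i = 1%N -> B i l -> l = (pi^-1)%g i.
  move=> ri Bl; apply/eqP/negPn/negP => ll.
  move: ri; rewrite /rowsum (bigD1 l) //= (bigD1 (pi^-1%g i)) /=; last by rewrite eq_sym.
  by rewrite Bl Hr.
move/orP: hB => [/existsP[i /eqP ri]|/existsP[i /existsP[k /and5P[ik Bi Bk /eqP ri /eqP rk]]]].
  by have := rowsum_gt0 (Hr i); rewrite ri.
move/negP: ik; apply; apply/eqP.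
by apply: (@perm_inj _ pi^-1%g); rewrite -(one i j) // -(one k j).
Qed.

(* The column [c] has already been treated. *)
Definition settled B (c : 'I_n) : Prop :=
  exists r, forall k l, (k == r) || (l == c) -> B k l = (k == r) && (l == c).

Lemma settled_reduce B i j c : B i j -> settled B c -> settled (reduce B i j) c.
Proof.
move=> B_ij [r rc]; exists r => k l kl; rewrite mxE.
(* Either [(i, j)] is the isolated entry [(r, c)], or it differs from it in both coordinates. *)
have [ir|ir] := eqVneq i r.
  have jc : j = c.
    by apply/eqP; have := rc i j; rewrite ir eqxx /= -ir B_ij => <-.
  by rewrite ir jc kl; case: ifP.
have jc : j != c.
  by apply: contraNneq ir => jc; have := rc i j; rewrite jc eqxx orbT andbT -jc B_ij => <-.
move/orP: kl => [/eqP->|/eqP->].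
  rewrite [r == i]eq_sym (negPf ir) eqxx /=.
  case: (eqVneq l j) => [->|lj]; first by rewrite (negPf jc).
  by rewrite rc eqxx.
rewrite [c == j]eq_sym (negPf jc) eqxx andbF orbF andbT.
case: (eqVneq k i) => [->|ki]; first by rewrite (negPf ir).
by rewrite rc eqxx ?orbT // andbT.
Qed.

Lemma settled_new B i j : settled (reduce B i j) j.
Proof.
exists i => k l kl; rewrite mxE kl.
by case: ifP.
Qed.

(** Each column has a single one, alone in its row, so [B] is a permutation matrix and all its row
    sums are 1. *)
Lemma all_settled B : (forall c, settled B c) ->
  exists pi0, perfect_matchings B = [set pi0] /\ Mt R B = 1.
Proof.
move=> H; have [f Hf] := choice H.
have finj : injective f.
  move=> c d fcd; have B1 : B (f d) d by rewrite (Hf d) ?eqxx.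
  by have := Hf c (f c) d; rewrite eqxx fcd B1 /= => /(_ isT) /esym/eqP.
exists (perm finj); split.
  apply/setP => pi; rewrite !inE; apply/forallP/eqP => [pB|-> j].
    apply/permP => j; rewrite permE; apply/eqP.
    by have := pB j; rewrite (Hf j) ?eqxx ?orbT // andbT.
  by rewrite permE (Hf j) ?eqxx.
rewrite /Mt big1 // => i _.
have [f' fK f'K] := injF_bij finj.
have -> : rowsum B i = 1%N.
  rewrite /rowsum (bigD1 (f' i)) //= big1 => [|l lf].
    by rewrite (Hf (f' i)) f'K ?eqxx.
  by rewrite (Hf (f' i)) f'K ?eqxx // (negPf lf).
by rewrite divff ?gt_eqF ?expR_gt0.
Qed.

Definition match_update (l : seq 'I_n) (m : {ffun 'I_n -> option 'I_n}) pi :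
    {ffun 'I_n -> option 'I_n} :=
  [ffun c => if c \in l then Some (pi c) else m c].

(** After a failure the remaining columns are still treated, with further draws, but [accept] stays
    false and each law sums to 1. *)
Lemma columns_failed (G : option {ffun 'I_n -> option 'I_n} -> R) l B m :
  foldr (@columnE R n) ((fun o => (G o)%:E) \o @pass_outcome n) l
    (PassState B false m) = (G None)%:E.
Proof.
elim: l B m => [//|j l IH] B m /=; rewrite /columnE /=.
case: ifPn => [_|/row_law_dist hd]; first exact: IH.
have -> : (fun o => if o is Some i then
    foldr (@columnE R n) ((fun o => (G o)%:E) \o @pass_outcome n) l
      (PassState (reduce B i j) false [ffun c => if c == j then Some i else m c])
    else foldr (@columnE R n) ((fun o => (G o)%:E) \o @pass_outcome n) l
      (PassState B false m)) = (fun=> (G None)%:E).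
  by apply/funext => -[i|]; rewrite IH.
rewrite draw_EFin // -mulr_suml.
by have /andP[_ /eqP ->] := hd; rewrite mul1r.
Qed.

(** The invariant behind the telescoping: from [B], each of its perfect matchings is accepted with
    probability [1 / Mt R B], and the remaining mass is failure. *)
Lemma columns_value (G : option {ffun 'I_n -> option 'I_n} -> R) l B m :
  (forall c, c \notin l -> settled B c) ->
  foldr (@columnE R n) ((fun o => (G o)%:E) \o @pass_outcome n) l
    (PassState B true m) =
  (G None + (\sum_(pi in perfect_matchings B)
     (G (Some (match_update l m pi)) - G None)) / Mt R B)%:E.
Proof.
elim: l B m => [|j l IH] B m sB.
  have [|pi0 [-> ->]] := @all_settled B; first by move=> c; exact: sB.
  rewrite big_set1 divr1 subrKC /= /pass_outcome /=; congr (G (Some _))%:E.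
  by apply/ffunP => c; rewrite ffunE.
rewrite /= /columnE /=; case: ifPn => [hB|hB].
  rewrite columns_failed (hopeless_no_matching hB).
  by rewrite big_set0 mul0r addr0.
have [r0 _] := hopelessPn hB; have M0 := Mt_gt0 r0.
(* Rows with [B i j] false are outside the reach of the induction hypothesis but have probability 0;
   their value 0 is a placeholder. *)
pose h o : R := if o is Some i then
    if B i j then G None + (\sum_(pi in perfect_matchings (reduce B i j))
     (G (Some (match_update l [ffun c => if c == j then Some i else m c] pi))
       - G None)) / Mt R (reduce B i j) else 0
  else G None.
transitivity (\sum_o row_law R B j o * h o)%:E.
  rewrite -(draw_EFin _ 0%E (row_law_dist hB)) /draw row_law_dist //.
  apply: eq_bigr => -[i|] _; last by rewrite columns_failed.
  rewrite /h /=; case: ifP => B_ij; last by rewrite !mul0e.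
  rewrite IH // => c cl; have [->|cj] := eqVneq c j; first exact: settled_new.
  by apply: settled_reduce => //; apply: sB; rewrite inE negb_or cj.
congr _%:E; rewrite big_option /row_law /h.
rewrite mulrBl mul1r -addrA; congr (_ + _); rewrite mulr_suml addrC -sumrB.
(* Matchings are grouped by the row matched to column [j]: when [B i j], the class of [i] consists
   of the matchings of [reduce B i j]. *)
rewrite (partition_big (fun pi => pi j) xpredT) //= mulr_suml.
apply: eq_bigr => i _; case: ifP => B_ij; last first.
  rewrite !mul0r subrr big1 ?mul0r // => pi /andP[].
  by rewrite inE => /forallP/(_ j) + /eqP pij; rewrite pij B_ij.
rewrite mulrDr addrAC subrr add0r.
have E : \sum_(pi in perfect_matchings (reduce B i j))
     (G (Some (match_update l [ffun c => if c == j then Some i else m c] pi))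
       - G None) =
  \sum_(pi in perfect_matchings B | pi j == i)
     (G (Some (match_update (j :: l) m pi)) - G None).
  apply: eq_big => [pi|pi]; first by rewrite perfect_matching_reduce.
  rewrite perfect_matching_reduce // => /andP[_ /eqP pij]; congr (G (Some _) - _).
  apply/ffunP => c; rewrite !ffunE inE; case: (c \in l); rewrite ?orbT // orbF.
  by case: eqP => // ->; rewrite pij.
(* [Mt R (reduce B i j)] is 0 when a row has become empty, but then no matching is left; if there is
   one, [Mt] is positive and cancels. *)
rewrite -E; have [|[pi pi_in]] := set_0Vmem (perfect_matchings (reduce B i j)).
  by move=> ->; rewrite big_set0 !mul0r mulr0.
have M1 : 0 < Mt R (reduce B i j).
  apply: Mt_gt0 => k; apply: (@rowsum_gt0 _ _ (pi^-1%g k)).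
  by move: pi_in; rewrite inE => /forallP/(_ (pi^-1%g k)); rewrite permKV.
by field; rewrite !gt_eqF.
Qed.

Lemma passE_value (A : 'M[bool]_n) (G : option {ffun 'I_n -> option 'I_n} -> R) :
  passE A (fun o => (G o)%:E) =
  (G None + (\sum_(pi in perfect_matchings A)
     (G (Some [ffun j => Some (pi j)]) - G None)) / Mt R A)%:E.
Proof.
rewrite /passE columns_value; last by move=> c; rewrite mem_enum.
congr (_ + _ / _)%:E; apply: eq_bigr => pi _; congr (G (Some _) - _).
by apply/ffunP => c; rewrite !ffunE mem_enum.
Qed.

End Matrix.
End Process.

(** * Deterministic subprograms *)

Section Exec.
Variables (R : realType) (n : nat).
Implicit Types (s : memory R) (c : cmd R).

Fixpoint deterministic c : bool :=
  match c with
  | Skip | NSet _ _ _ _ | RSet _ _ _ _ => true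
  | Seq c1 c2 | If _ c1 c2 => deterministic c1 && deterministic c2
  | For _ e c1 => if e is NSize then deterministic c1 else false
  | Draw _ _ _ | Repeat _ _ => false
  end.

(* [exec] and [cost_bound] are meaningful on [deterministic] commands only; in
   particular they take every loop to run over [NSize]. *)
Fixpoint exec c s : memory R :=
  match c with
  | NSet x i k e => nset s x (neval n i s) (neval n k s) (neval n e s)
  | RSet x i k e => rset s x (neval n i s) (neval n k s) (reval n e s)
  | Seq c1 c2 => exec c2 (exec c1 s)
  | If b c1 c2 => if beval n b s then exec c1 s else exec c2 s
  | For x e c1 =>
      foldl (fun s' i => exec c1 (nset s' x 0 0 i)) s (iota 0 n)
  | _ => s
  end.

Fixpoint cost_bound c : nat :=
  match c with
  | Skip => 1
  | NSet _ i k e => 1 + ncost i + ncost k + ncost e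
  | RSet _ i k e => 1 + ncost i + ncost k + rcost e
  | Seq c1 c2 => 1 + cost_bound c1 + cost_bound c2
  | If b c1 c2 => 1 + bcost b + cost_bound c1 + cost_bound c2
  | For _ e c1 => 1 + ncost e + n * (1 + cost_bound c1)
  | _ => 0
  end%N.

Lemma tickD b k l : (tick R b k + tick R b l)%E = tick R b (k + l).
Proof. by case: b => /=; rewrite ?adde0 // -EFinD natrD. Qed.

(** Lets a deterministic command be replaced by its final memory, in both readings of [expect]. The
    cost depends on the branches taken; its bound is uniform in [s]. *)
Lemma expect_det b c s f : deterministic c ->
  exists2 k, (k <= cost_bound c)%N &
    expect b n c f s = (tick R b k + f (exec c s))%E.
Proof.
elim: c s f => [|x i k e|x i k e|c1 IH1 c2 IH2|t c1 IH1 c2 IH2|x e c1 IH||//] s f //=.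
- by move=> _; exists 1%N.
- by move=> _; eexists; last by [].
- by move=> _; eexists; last by [].
- case/andP=> /IH1 {}IH1 /IH2 {}IH2.
  have [k1 k1b ->] := IH1 s (expect b n c2 f).
  have [k2 k2b ->] := IH2 (exec c1 s) f.
  exists (1 + k1 + k2)%N; first by rewrite !leq_add.
  by rewrite !addeA !tickD.
- case/andP=> /IH1 {}IH1 /IH2 {}IH2; case: ifP => _.
    have [k1 k1b ->] := IH1 s f; exists (1 + bcost t + k1)%N; first by lia.
    by rewrite addeA tickD.
  have [k1 k1b ->] := IH2 s f; exists (1 + bcost t + k1)%N; first by lia.
  by rewrite addeA tickD.
case: e => // /IH {}IH /=.
have loop l : forall s, exists2 k, (k <= size l * (1 + cost_bound c1))%N &
  foldr (fun i F s' => (tick R b 1 + expect b n c1 F (nset s' x 0 0 i))%E) f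
    l s =
  (tick R b k + f (foldl (fun s' i => exec c1 (nset s' x 0 0 i)) s l))%E.
  elim: l => [|i l IHl] {}s /=.
    by exists 0%N => //; case: (b); rewrite /= add0e.
  set F := foldr _ _ _; have [k1 k1b ->] := IH (nset s x 0 0 i) F.
  rewrite /F; have [k2 k2b ->] := IHl (exec c1 (nset s x 0 0 i)).
  exists (1 + k1 + k2)%N; last by rewrite !addeA !tickD.
  by rewrite mulSn !leq_add.
have [k kb ->] := loop (iota 0 n) s; rewrite size_iota in kb.
exists (1 + 1 + k)%N; last by rewrite addeA tickD.
by rewrite leq_add2l.
Qed.

Fixpoint nwrites c : seq string :=
  match c with
  | NSet x _ _ _ => [:: x]
  | Seq c1 c2 | If _ c1 c2 => nwrites c1 ++ nwrites c2
  | For x _ c1 => x :: nwrites c1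
  | _ => [::]
  end.

Fixpoint rwrites c : seq string :=
  match c with
  | RSet x _ _ _ => [:: x]
  | Seq c1 c2 | If _ c1 c2 => rwrites c1 ++ rwrites c2
  | For _ _ c1 => rwrites c1
  | _ => [::]
  end.

Lemma nm_frame c s y : ~~ has (String.eqb y) (nwrites c) ->
  nm (exec c s) y = nm s y.
Proof.
elim: c s => //= [x i k e|c1 IH1 c2 IH2|t c1 IH1 c2 IH2|x e c1 IH] s.
- rewrite orbF => /negPf yx; apply/funext => a; apply/funext => b.
  by rewrite /upd yx.
- by rewrite has_cat negb_or => /andP[h1 h2]; rewrite IH2 // IH1.
- by rewrite has_cat negb_or => /andP[h1 h2]; case: ifP => _; [apply: IH1|apply: IH2].
rewrite negb_or => /andP[/negPf yx h]; elim: (iota 0 n) s => //= i l IHl s.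
rewrite IHl IH //=; apply/funext => a; apply/funext => b.
by rewrite /upd yx.
Qed.

Lemma rm_frame c s y : ~~ has (String.eqb y) (rwrites c) ->
  rm (exec c s) y = rm s y.
Proof.
elim: c s => //= [x i k e|c1 IH1 c2 IH2|t c1 IH1 c2 IH2|x e c1 IH] s.
- rewrite orbF => /negPf yx; apply/funext => a; apply/funext => b.
  by rewrite /upd yx.
- by rewrite has_cat negb_or => /andP[h1 h2]; rewrite IH2 // IH1.
- by rewrite has_cat negb_or => /andP[h1 h2]; case: ifP => _; [apply: IH1|apply: IH2].
by move=> h; elim: (iota 0 n) s => //= i l IHl s; rewrite IHl IH.
Qed.

(** The invariant rule for loops with the frame built in: the body may assume that whatever the loop
    does not write is as in the initial [s], so that invariants mention only the written arrays. *)
Lemma for_inv x c s (I : nat -> memory R -> Prop) : I 0%N s ->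
  (forall i s', (i < n)%N ->
    (forall y, ~~ has (String.eqb y) (x :: nwrites c) -> nm s' y = nm s y) ->
    (forall y, ~~ has (String.eqb y) (rwrites c) -> rm s' y = rm s y) ->
    I i s' -> I i.+1 (exec c (nset s' x 0 0 i))) ->
  I n (exec (For x NSize c) s).
Proof.
move=> I0 step /=.
pose J k s' := [/\ I k s',
    forall y, ~~ has (String.eqb y) (x :: nwrites c) -> nm s' y = nm s y
  & forall y, ~~ has (String.eqb y) (rwrites c) -> rm s' y = rm s y].
suff H k l : (k + size l <= n)%N -> l = iota k (size l) ->
    forall s', J k s' ->
    J (k + size l)%N (foldl (fun s' i => exec c (nset s' x 0 0 i)) s' l).
  have [||//|] := H 0%N (iota 0 n) _ _ s; rewrite ?size_iota //.
elim: l k => [|i l IH] k; first by rewrite addn0.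
rewrite /= -addSnnS => kn [-> El] s' [Ik fn fr].
apply: IH => //; split; first by apply: step => //; lia.
- move=> y yx; rewrite nm_frame; last by move: yx; rewrite /= negb_or => /andP[].
  rewrite -fn //; apply/funext => a; apply/funext => b.
  by move: yx; rewrite /= /upd negb_or => /andP[/negPf -> _].
- by move=> y yx; rewrite rm_frame // -fr.
Qed.

End Exec.
Arguments exec : simpl never.

(** * What each subprogram computes *)

Section Specs.
Variables (R : realType) (n : nat).
Implicit Types (s : memory R).

Lemma count_iotaS (p : pred nat) i : count p (iota 0 i.+1) = (count p (iota 0 i) + p i)%N.
Proof. by rewrite -addn1 iotaD count_cat /= addn0. Qed.

Lemma has_iotaS (p : pred nat) i : has p (iota 0 i.+1) = has p (iota 0 i) || p i.
Proof. by rewrite -addn1 iotaD has_cat /= orbF. Qed.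

Local Open Scope string_scope.

Let row_copy : cmd R :=
  For "k" NSize (Seq
    (NSet "At" (nv "i") (nv "k") (NVar "A" (nv "i") (nv "k")))
    (nset1 R "r" (nv "i") (NAdd (nv1 "r" (nv "i")) (NVar "At" (nv "i") (nv "k"))))).

Lemma row_copy_spec s i : nm s "i" 0 0 = i -> nm s "r" i 0 = 0%N ->
  let s' := exec n row_copy s in
  [/\ forall k, (k < n)%N -> nm s' "At" i k = nm s "A" i k,
      nm s' "r" i 0 = (\sum_(k < n) nm s "A" i k)%N
    & forall a, a != i -> nm s' "At" a =1 nm s "At" a /\ nm s' "r" a 0 = nm s "r" a 0].
Proof.
move=> si sr /=.
pose I k s' := [/\ forall b, (b < k)%N -> nm s' "At" i b = nm s "A" i b,
      nm s' "r" i 0 = (\sum_(b < k) nm s "A" i b)%N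
    & forall a, a != i -> nm s' "At" a =1 nm s "At" a /\ nm s' "r" a 0 = nm s "r" a 0].
apply: (@for_inv _ _ _ _ _ I) => [|k s' kn fn _ [I1 I2 I3]]; first by rewrite /I big_ord0.
have s'i : nm s' "i" 0 0 = i by rewrite fn.
have s'A : nm s' "A" = nm s "A" by rewrite fn.
rewrite /I /exec /= /upd /= !eqxx s'i s'A; split=> [b|| a ai].
- rewrite ltnS leq_eqVlt eqxx /=; case: eqP => [->//|_] /= bk; exact: I1.
- by rewrite eqxx /= big_ord_recr /= I2.
- rewrite (negPf ai) /=; split; last by have [_ ->] := I3 _ ai.
  by move=> b; have [-> _] := I3 _ ai.
Qed.

Let rows_copy : cmd R :=
  For "i" NSize (Seq (nset1 R "r" (nv "i") (NC 0)) row_copy).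

Lemma rows_copy_spec s :
  let s' := exec n rows_copy s in
  (forall i k, (i < n)%N -> (k < n)%N -> nm s' "At" i k = nm s "A" i k) /\
  (forall i, (i < n)%N -> nm s' "r" i 0 = (\sum_(k < n) nm s "A" i k)%N).
Proof.
move=> /=.
pose I j s' := forall i, (i < j)%N ->
  (forall k, (k < n)%N -> nm s' "At" i k = nm s "A" i k) /\
  nm s' "r" i 0 = (\sum_(k < n) nm s "A" i k)%N.
suff H : I n (exec n rows_copy s).
  by split=> [i k iN kN|i iN]; have [h1 h2] := H i iN; [exact: h1|exact: h2].
apply: (@for_inv _ _ _ _ _ I) => // j s' jn fn _ IH i.
rewrite -[exec _ _ _]/(exec n row_copy
  (exec n (nset1 R "r" (nv "i") (NC 0)) (nset s' "i" 0 0 j))).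
set s1 := exec n (nset1 _ _ _ _) _.
have [||H1 H2 H3] := @row_copy_spec s1 j.
- by rewrite /s1 /exec /= /upd.
- by rewrite /s1 /exec /= /upd /= eqxx.
have s1A : nm s1 "A" = nm s "A" by rewrite -(fn "A").
rewrite s1A in H1 H2.
rewrite ltnS leq_eqVlt; case: eqP => [->//|/eqP ij] /= /IH[IH1 IH2].
have [H4 H5] := H3 _ ij; split.
  move=> k kn; rewrite H4 -(IH1 _ kn).
  by rewrite /s1 /exec /= /upd.
by rewrite H5 -IH2 /s1 /exec /= /upd /= (negPf ij).
Qed.

Let g_table : cmd R :=
  For "a" NSize (
    If (BEq (nv "a") (NC 0)) Skip
      (let ga := rv1 R "g" (nv "a") in
       rset1 "g" (NAdd (nv "a") (NC 1))
         (RAdd (RAdd (RAdd ga (RC 1)) (RDiv (RC 1) (RMul (RC 2) ga)))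
               (RDiv (RDiv (RC 6) (RC 10)) (RMul ga ga))))).

Lemma g_table_spec s : rm s "g" 0 0 = 0 -> rm s "g" 1 0 = expR 1 ->
  forall a, (a <= n)%N -> rm (exec n g_table s) "g" a 0 = g R a.
Proof.
move=> g0 g1.
(* Entry 1 is kept separately: at [k = 0] the last clause does not cover it, while the first
   iteration only skips. *)
pose I k s' := rm s' "g" 0 0 = 0 /\ rm s' "g" 1 0 = expR 1 /\
  forall a, (a <= k)%N -> rm s' "g" a 0 = g R a.
suff [_ [_]] : I n (exec n g_table s) by [].
apply: (@for_inv _ _ _ _ _ I) => [|k s' kn _ _ [I0 [I1 IH]]].
  by split=> //; split=> // a; rewrite leqn0 => /eqP ->.
rewrite /I /exec /= /upd /=; case: k kn IH => [|k] kn IH /=.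
  by split=> //; split=> // -[|[|]].
rewrite addn1 /upd /=; split=> //; split=> // a; rewrite andbT leq_eqVlt.
case: eqP => [->|_] /=; last by rewrite ltnS => /IH.
by rewrite (IH k.+1) // expr2.
Qed.

Lemma init_pass_spec s :
  let s' := exec n (init_pass R) s in
  [/\ nm s' "accept" 0 0 = 1%N,
      forall i k, (i < n)%N -> (k < n)%N -> nm s' "At" i k = nm s "A" i k,
      forall i, (i < n)%N -> nm s' "r" i 0 = (\sum_(k < n) nm s "A" i k)%N
    & forall a, (a <= n)%N -> rm s' "g" a 0 = g R a].
Proof.
pose s1 := exec n (nset0 R "accept" (NC 1)) s.
pose s2 := exec n rows_copy s1.
pose s3 := exec n (Seq (rset1 "g" (NC 0) (RC 0)) (rset1 "g" (NC 1) (RC (expR 1)))) s2.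
rewrite -[exec n (init_pass R) s]/(exec n g_table s3) /=.
have [H1 H2] := rows_copy_spec s1.
have s1A : nm s1 "A" = nm s "A" by [].
split.
- by rewrite nm_frame // /s3 nm_frame // /s2 nm_frame.
- by move=> i k iN kN; rewrite nm_frame // /s3 nm_frame // H1.
- by move=> i iN; rewrite nm_frame // /s3 nm_frame // H2.
apply: g_table_spec; by rewrite /s3 /exec /= /upd.
Qed.

Lemma check_column_spec s :
  let j := nm s "j" 0 0 in
  let single i := (nm s "At" i j == 1%N) && (nm s "r" i 0 == 1%N) in
  nm (exec n (check_column R) s) "bad" 0 0 =
  (has (fun i => nm s "r" i 0 == 0%N) (iota 0 n) ||
   (1 < count single (iota 0 n))%N).
Proof.
move=> j single; pose zero i := nm s "r" i 0 == 0%N; rewrite -/(has zero _).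
set s1 := exec n (Seq (nset0 R "bad" (NC 0)) (nset0 R "single" (NC 0))) s.
(* The flag [single] remembers that one candidate was met; the second one raises [bad]. *)
pose I k (s' : memory R) :=
  nm s' "bad" 0 0 = (has zero (iota 0 k) || (1 < count single (iota 0 k))%N) /\
  nm s' "single" 0 0 = (0 < count single (iota 0 k))%N.
rewrite /check_column; set body := For "i" _ _.
rewrite -[exec n _ s]/(exec n body s1).
suff [->] : I n (exec n body s1) by [].
apply: for_inv => // i s' _ fn _ [I1 I2].
have s'A : nm s' "At" = nm s "At" by rewrite fn.
have s'r : nm s' "r" = nm s "r" by rewrite fn.
have s'j : nm s' "j" 0 0 = j by rewrite fn.
rewrite /I has_iotaS count_iotaS.
set B := has zero _ in I1 *; set c := count _ _ in I1 I2 *.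
have E : (nm s "At" i j == 1%N) && (nm s "r" i 0 == 1%N) = single i by [].
rewrite /exec /= /upd /= s'r -/(zero i); clearbody B c.
case: (zero i); rewrite /= /upd /= !(s'A, s'r, s'j) ?E;
  case: (single i); case: c I1 I2 => [|[|c]] I1 I2;
  rewrite /= ?I2 /= /upd /= ?I1 ?I2 ?addn0 ?addn1 ?orbT ?orbF //.
Qed.

Lemma column_law_spec s :
  let j := nm s "j" 0 0 in
  let gr a := rm s "g" a 0 in
  let r i := nm s "r" i 0 in
  let q i := if nm s "At" i j == 1%N then gr (r i - 1)%N / gr (r i) else 1 in
  let p i := if nm s "At" i j == 1%N then
      gr 1%N / gr (r i) * ((\prod_(0 <= k < i) q k) * \prod_(i.+1 <= k < n) q k)
    else 0 in
  let s' := exec n (column_law R) s in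
  (forall i, (i < n)%N -> rm s' "p" i 0 = p i) /\
  rm s' "p" n 0 = 1 - \sum_(i < n) p i.
Proof.
move=> j gr r q p.
set c1 := For "i" NSize (If (BEq (NVar "At" (nv "i") (nv "j")) (NC 1))
      (rset1 "q" (nv "i") (RDiv (rv1 R "g" (NSub (nv1 "r" (nv "i")) (NC 1)))
                                (rv1 R "g" (nv1 "r" (nv "i")))))
      (rset1 "q" (nv "i") (RC 1))).
have H1 : forall i, (i < n)%N -> rm (exec n c1 s) "q" i 0 = q i.
  pose I k (s' : memory R) := forall i, (i < k)%N -> rm s' "q" i 0 = q i.
  apply: (@for_inv _ _ _ _ _ I) => // i s' iN fn fr IH k.
  have s'A : nm s' "At" = nm s "At" by rewrite fn.
  have s'r : nm s' "r" = nm s "r" by rewrite fn.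
  have s'j : nm s' "j" 0 0 = j by rewrite fn.
  have s'g : rm s' "g" = rm s "g" by rewrite fr.
  rewrite /exec /= /upd /= s'A s'j s'r ltnS leq_eqVlt.
  case: ifP => Aij; rewrite /= /upd /= ?s'g ?s'r; case: eqP => [->|_] /=.
  - by rewrite /q Aij.
  - exact: IH.
  - by rewrite /q Aij.
  - exact: IH.
set s1 := exec n c1 s in H1.
set c2 := For "i" NSize
  (rset1 "L" (NAdd (nv "i") (NC 1)) (RMul (rv1 R "L" (nv "i")) (rv1 R "q" (nv "i")))).
set s2 := exec n c2 (exec n (rset1 "L" (NC 0) (RC 1)) s1).
have H2 : forall i, (i <= n)%N -> rm s2 "L" i 0 = \prod_(0 <= k < i) q k.
  pose I k (s' : memory R) := forall i, (i <= k)%N ->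
    rm s' "L" i 0 = \prod_(0 <= l < i) q l.
  apply: (@for_inv _ _ _ _ _ I) => [i|k s' kN fn fr IH i].
    by rewrite leqn0 => /eqP ->; rewrite big_nil /exec /= /upd.
  have s'q : rm s' "q" = rm s1 "q" by rewrite fr // rm_frame.
  rewrite /exec /= addn1 /upd /= s'q H1 // leq_eqVlt andbT.
  case: eqP => [->|_] /=; last by rewrite ltnS => /IH.
  by rewrite big_nat_recr //= IH.
set c3 := For "i" NSize (rset1 "U" (NSub NSize (NAdd (nv "i") (NC 1)))
   (RMul (rv1 R "q" (NSub NSize (NAdd (nv "i") (NC 1))))
     (rv1 R "U" (NAdd (NSub NSize (NAdd (nv "i") (NC 1))) (NC 1))))).
set s3 := exec n c3 (exec n (rset1 "U" NSize (RC 1)) s2).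
(* The loop fills [U] from index [n] downwards, so the invariant runs over the distance [i] to
   [n]. *)
have H3 : forall i, (i <= n)%N -> rm s3 "U" (n - i)%N 0 = \prod_(n - i <= k < n) q k.
  pose I k (s' : memory R) := forall i, (i <= k)%N ->
    rm s' "U" (n - i)%N 0 = \prod_(n - i <= l < n) q l.
  apply: (@for_inv _ _ _ _ _ I) => [i|k s' kN fn fr IH i].
    rewrite leqn0 => /eqP ->; rewrite subn0 big_geq // /exec /= /upd /=.
    by rewrite eqxx.
  have s'q : rm s' "q" = rm s1 "q" by rewrite fr // rm_frame // /s2 2?rm_frame.
  rewrite /exec /= /upd /= s'q H1 ?addn1; last by lia.
  rewrite andbT leq_eqVlt; case: (eqVneq i k.+1) => [->|ik] /=.
    rewrite eqxx subnSK // IH // [in RHS]big_ltn ?subnSK //; lia.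
  move=> ik1; have -> : (n - i == n - k.+1)%N = false by lia.
  by apply: IH; lia.
set c4 := For "i" NSize (Seq (If (BEq (NVar "At" (nv "i") (nv "j")) (NC 1))
      (rset1 "p" (nv "i") (RMul (RDiv (rv1 R "g" (NC 1)) (rv1 R "g" (nv1 "r" (nv "i"))))
                         (RMul (rv1 R "L" (nv "i")) (rv1 R "U" (NAdd (nv "i") (NC 1))))))
      (rset1 "p" (nv "i") (RC 0)))
    (rset1 "p" NSize (RSub (rv1 R "p" NSize) (rv1 R "p" (nv "i"))))).
set s4 := exec n (rset1 "p" NSize (RC 1)) s3.
rewrite -[exec n (column_law R) s]/(exec n c4 s4) /=.
pose I k (s' : memory R) := (forall i, (i < k)%N -> rm s' "p" i 0 = p i) /\
  rm s' "p" n 0 = 1 - \sum_(i < k) p i.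
apply: (@for_inv _ _ _ _ _ I) => [|k s' kN fn fr [IH1 IH2]].
  by split=> //; rewrite big_ord0 subr0 /s4 /exec /= /upd /= eqxx.
have s'A : nm s' "At" = nm s "At" by rewrite fn // /s4 /s3 /s2 /s1 6?nm_frame.
have s'r : nm s' "r" = nm s "r" by rewrite fn // /s4 /s3 /s2 /s1 6?nm_frame.
have s'j : nm s' "j" 0 0 = j by rewrite fn // /s4 /s3 /s2 /s1 6?nm_frame.
have s'g : rm s' "g" = rm s "g" by rewrite fr // /s4 /s3 /s2 /s1 6?rm_frame.
have s'L : rm s' "L" = rm s2 "L" by rewrite fr // /s4 /s3 3?rm_frame.
have s'U : rm s' "U" = rm s3 "U" by rewrite fr // /s4 rm_frame.
have Uk : rm s3 "U" k.+1 0 = \prod_(k.+1 <= l < n) q l.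
  by rewrite -(subKn kN) H3 // leq_subr.
have nk : (n == k) = false by lia.
have kn : (k == n) = false by lia.
rewrite /I big_ord_recr /= /exec /= /upd /= s'A s'j s'L s'U s'r s'g addn1 Uk.
rewrite (H2 _ (ltnW kN)).
have E : (if nm s "At" k j == 1%N then rm s "g" 1 0 / rm s "g" (nm s "r" k 0) 0 *
   (\prod_(0 <= k0 < k) q k0 * \prod_(k.+1 <= l < n) q l) else 0) = p k by [].
split=> [i|]; last first.
  rewrite eqxx /= -E.
  case: ifP => _; rewrite /= /upd /= nk eqxx /= opprD addrA IH2 // eqxx //.
rewrite ltnS leq_eqVlt => ik; have -> : (i == n) = false by lia.
rewrite /=; move: E; case: ifP => _ E; rewrite /= /upd /= andbT.
  by case: eqP ik => [->|_] //= /IH1.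
by case: eqP ik => [->|_] //= /IH1.
Qed.

Lemma select_row_spec s :
  let j := nm s "j" 0 0 in
  let row := nm s "R" 0 0 in
  (row < n)%N -> (j < n)%N ->
  let s' := exec n (select_row R) s in
  [/\ forall i k, (i < n)%N -> (k < n)%N -> nm s' "At" i k =
        if i == row then (k == j : nat)
        else if (k == j) && (nm s "At" i k == 1%N) then 0%N else nm s "At" i k,
      forall i, (i < n)%N -> nm s' "r" i 0 =
        if i == row then 1%N else (nm s "r" i 0 - (nm s "At" i j == 1))%N
    & forall k, nm s' "pi" k 0 = if k == j then row else nm s "pi" k 0].
Proof.
move=> j row rowN jN.
set s1 := exec n (nset1 R "pi" (nv "j") (nv "R")) s.
set c2 := For "i" NSize (If (BEq (NVar "At" (nv "i") (nv "j")) (NC 1))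
  (Seq (NSet "At" (nv "i") (nv "j") (NC 0))
       (nset1 R "r" (nv "i") (NSub (nv1 "r" (nv "i")) (NC 1)))) Skip).
set s2 := exec n c2 s1.
set c3 := For "i" NSize (NSet "At" (nv "R") (nv "i") (NC 0) : cmd R).
set s3 := exec n c3 s2.
set s4 := exec n (Seq (NSet "At" (nv "R") (nv "j") (NC 1)) (nset1 R "r" (nv "R") (NC 1))) s3.
rewrite -[exec n (select_row R) s]/s4 /=.
have s1A : nm s1 "At" = nm s "At" by [].
have s1r : nm s1 "r" = nm s "r" by [].
have H2 : (forall i k, (i < n)%N -> nm s2 "At" i k =
        if (k == j) && (nm s "At" i k == 1%N) then 0%N else nm s "At" i k) /\
      forall i, (i < n)%N -> nm s2 "r" i 0 = (nm s "r" i 0 - (nm s "At" i j == 1))%N.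
  (* Row [row] is treated like the others here; its entries and its sum are overwritten by the later
     assignments. *)
  pose I m (s' : memory R) := forall i,
    (forall k, nm s' "At" i k =
      if [&& (i < m)%N, k == j & nm s "At" i k == 1%N] then 0%N else nm s "At" i k) /\
    nm s' "r" i 0 = (nm s "r" i 0 - ((i < m)%N && (nm s "At" i j == 1)))%N.
  suff H : I n s2.
    by split=> [i k iN|i iN]; have [H1 H3] := H i; rewrite ?H1 ?H3 iN.
  apply: (@for_inv _ _ _ _ _ I) => [i|m s' mN fn fr IH i].
    by rewrite s1A s1r /= subn0.
  have s'j : nm s' "j" 0 0 = j by rewrite fn.
  have [IHA IHr] := IH i.
  have [IHAm IHrm] := IH m.
  rewrite /exec /= /upd /= s'j IHAm ltnn /=.
  rewrite ltnS leq_eqVlt.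
  case: ifP => Amj; rewrite /= /upd /= ?s'j.
    split=> [k|].
      rewrite IHA; case: (eqVneq i m) => [->|im] /=.
        by rewrite ltnn /=; case: (eqVneq k j) => [->|//] /=; rewrite Amj.
      by [].
    rewrite andbT; case: (eqVneq i m) => [->|im] /=.
      by rewrite IHrm ltnn /= subn0 Amj.
    by rewrite IHr.
  split=> [k|].
    rewrite IHA; case: (eqVneq i m) => [->|im] //=.
    by rewrite ltnn /=; case: (eqVneq k j) => [->|//] /=; rewrite Amj.
  by rewrite IHr; case: (eqVneq i m) => [->|im] //=; rewrite ltnn Amj.
have [H2A H2r] := H2.
have s2R : nm s2 "R" 0 0 = row by rewrite /s2 nm_frame.
have H3 : forall i k, nm s3 "At" i k = if (i == row) && (k < n)%N then 0%N else nm s2 "At" i k.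
  pose I m (s' : memory R) := forall i k,
    nm s' "At" i k = if (i == row) && (k < m)%N then 0%N else nm s2 "At" i k.
  apply: (@for_inv _ _ _ _ _ I) => [i k|m s' mN fn fr IH i k].
    by rewrite ltn0 andbF.
  have s'R : nm s' "R" 0 0 = row by rewrite fn.
  rewrite /exec /= /upd /= s'R IH ltnS [(k <= m)%N]leq_eqVlt.
  by case: (i == row); case: (k == m).
have s3R : nm s3 "R" 0 0 = row by rewrite /s3 nm_frame.
have s3j : nm s3 "j" 0 0 = j by rewrite /s3 nm_frame // /s2 nm_frame.
have s3r : nm s3 "r" = nm s2 "r" by rewrite /s3 nm_frame.
have s3pi : nm s3 "pi" = nm s1 "pi" by rewrite /s3 nm_frame // /s2 nm_frame.
split=> [i k iN kN|i iN|k].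
- rewrite /s4 /exec /= /upd /= s3R s3j H3 H2A // kN andbT.
  by case: (i == row); case: (k == j).
- by rewrite /s4 /exec /= /upd /= s3R s3r H2r // andbT.
rewrite /s4 /exec /= /upd /= s3pi /s1 /exec /= /upd /= andbT.
by [].
Qed.

End Specs.

(** * Simulation of a pass *)

Section Simulation.
Variables (R : realType) (n : nat).
Implicit Types (s : memory R) (c : cmd R).
Local Arguments expect : simpl never.

Lemma expect_seq b c1 c2 f s : expect b n (Seq c1 c2) f s =
  (tick R b 1 + expect b n c1 (expect b n c2 f) s)%E.
Proof. by []. Qed.

Lemma expect_if b t c1 c2 f s : expect b n (If t c1 c2) f s =
  (tick R b (1 + bcost t) +
   if beval n t s then expect b n c1 f s else expect b n c2 f s)%E.
Proof. by []. Qed.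

Lemma draw_bij (T T' : finType) (h : T -> T') (err : \bar R) (p : T' -> R)
    (F : T' -> \bar R) : bijective h ->
  draw err p F = draw err (p \o h) (F \o h).
Proof.
move=> hb; rewrite /draw.
have -> : is_dist p = is_dist (p \o h).
  rewrite /is_dist (reindex h) /=; last exact: onW_bij.
  congr (_ && _); apply/forallP/forallP => H t; first exact: H.
  by have [h' _ h'K] := hb; rewrite -(h'K t); exact: H.
by case: ifP => // _; rewrite (reindex h) //=; exact: onW_bij.
Qed.

(** In the extended reals 0 times anything is 0, so outcomes of probability 0 do not count, even
    with infinite value. This matters because the simulation holds only on the support of the
    law. *)
Lemma eq_draw (T : finType) (err : \bar R) (p p' : T -> R) (F F' : T -> \bar R) :
  p =1 p' -> (forall t, p t != 0 -> F t = F' t) -> draw err p F = draw err p' F'.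
Proof.
move=> pp FF; have -> : p' = p by apply/funext.
rewrite /draw; case: ifP => // _; apply: eq_bigr => t _.
by have [->|/FF ->] := eqVneq (p t) 0; rewrite ?mul0e.
Qed.

(** A uniform extra cost passes through a draw because the probabilities sum to 1. *)
Lemma draw_le (T : finType) (err : \bar R) (p : T -> R) (F G : T -> \bar R) K :
  is_dist p -> (forall t, 0 <= G t)%E -> 0 <= K ->
  (forall t, p t != 0 -> (F t <= K%:E + G t)%E) ->
  (draw err p F <= K%:E + draw 0 p G)%E.
Proof.
move=> pd G0 K0 FG; have /andP[/forallP p0 /eqP p1] := pd.
rewrite /draw pd.
apply: (@le_trans _ _ (\sum_t ((p t * K)%:E + (p t)%:E * G t))%E).
  apply: lee_sum => t _; have [->|pt] := eqVneq (p t) 0.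
    by rewrite !mul0e mul0r adde0.
  rewrite EFinM -ge0_muleDr ?lee_fin //.
  by apply: lee_wpmul2l; [rewrite lee_fin|exact: FG].
by rewrite big_split /= sumEFin -mulr_suml p1 mul1r.
Qed.

Lemma draw_ge0 (T : finType) (p : T -> R) (F : T -> \bar R) :
  (forall t, 0 <= F t)%E -> (0 <= draw 0 p F)%E.
Proof.
move=> F0; rewrite /draw; case: ifP => // /andP[/forallP p0 _].
by apply: sume_ge0 => t _; rewrite mule_ge0 ?lee_fin.
Qed.

Lemma columns_ge0 (F : pass_state n -> \bar R) l st :
  (forall t, 0 <= F t)%E -> (0 <= foldr (@columnE R n) F l st)%E.
Proof.
move=> F0; elim: l st => //= j l IH st; rewrite /columnE; case: ifP => _ //.
by apply: draw_ge0 => -[i|].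
Qed.

(* The programs encode the absence of a row as the index [n]. *)
Definition opt_ord (o : option 'I_n) : 'I_(n + 1) :=
  if o is Some i then lshift 1 i else rshift n ord0.

Lemma opt_ord_bij : bijective opt_ord.
Proof.
exists (fun k => insub (val k)) => [[i|]|k] /=.
- by rewrite valK.
- by rewrite insubF // addn0 ltnn.
case: insubP => [i _ ik|kn]; first exact: val_inj.
by apply: val_inj => /=; have := ltn_ord k; lia.
Qed.

(* Before column [j] is treated, [pi] holds junk from [j] on, and after a failure
   it is not constrained at all. *)
Definition simulates (A : 'M[bool]_n) (j : nat) s (st : pass_state n) : Prop :=
  [/\ input A s,
      forall i k : 'I_n, nm s "At" i k = cur st i k,
      forall i : 'I_n, nm s "r" i 0 = rowsum (cur st) i,
      forall a, (a <= n)%N -> rm s "g" a 0 = g R a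
    & nm s "accept" 0 0 = accept st /\ (accept st ->
        forall l : 'I_n, (l < j)%N -> match_of st l = insub (nm s "pi" l 0))].

Lemma rowsum_le (B : 'M[bool]_n) i : (rowsum B i <= n)%N.
Proof.
rewrite -[n in (_ <= n)%N]card_ord -sum1_card.
by apply: leq_sum => j _; case: (B _ _).
Qed.

Local Open Scope string_scope.

Definition col_body : cmd R :=
  Seq (check_column R)
    (If (BEq (nv "bad") (NC 1))
      (nset0 R "accept" (NC 0))
      (Seq (column_law R)
       (Seq (Draw "R" "p" (NAdd NSize (NC 1)))
       (If (BLt (nv "R") NSize)
         (select_row R)
         (nset0 R "accept" (NC 0)))))).

Lemma hopeless_check A j s st : simulates A j s st -> forall j' : 'I_n,
  nm s "j" 0 0 = j' ->
  nm (exec n (check_column R) s) "bad" 0 0 = hopeless (cur st) j'.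
Proof.
move=> [_ sA sr _ _] j' sj; rewrite check_column_spec /= sj /hopeless.
rewrite -val_enum_ord has_map count_map.
congr (_ || _).
  apply/hasP/existsP => [[i _ /=]|[i]]; rewrite ?sr; first by exists i.
  by move=> ri; exists i; rewrite ?mem_enum //= sr.
set P := [pred i : 'I_n | cur st i j' & rowsum (cur st) i == 1%N].
have -> : count [eta preim val (fun i => (nm s "At" i j' == 1%N) && (nm s "r" i 0 == 1%N))]
    (enum 'I_n) = #|P|.
  rewrite -sum1_count big_enum_cond /= -sum1_card; apply: eq_bigl => i /=.
  by rewrite sA sr inE eqb1.
apply/card_gt1P/existsP => [[x [y [Px Py xy]]]|[x /existsP[y /and5P[xy H1 H2 H3 H4]]]].
  move: Px Py; rewrite !inE => /andP[H1 H2] /andP[H3 H4].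
  by exists x; apply/existsP; exists y; rewrite xy H1 H3 H2 H4.
by exists x, y; rewrite !inE H1 H2 H3 H4.
Qed.

Lemma prod_skip (F : nat -> R) (i : 'I_n) :
  (\prod_(0 <= k < i) F k) * \prod_(i.+1 <= k < n) F k = \prod_(k < n | k != i) F k.
Proof.
rewrite -(big_mkord (fun k => k != i) F) [RHS](@big_cat_nat _ _ _ i) //=; last exact: ltnW.
rewrite [X in _ = _ * X]big_ltn_cond //= eqxx /=; congr (_ * _).
  rewrite big_nat_cond [RHS]big_nat_cond; apply: eq_bigl => k; lia.
rewrite big_nat_cond [RHS]big_nat_cond; apply: eq_bigl => k; lia.
Qed.

Lemma law_simulates A (j : 'I_n) s st : simulates A j s st ->
  nm s "j" 0 0 = j -> (forall i, 0 < rowsum (cur st) i)%N ->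
  forall o, rm (exec n (column_law R) s) "p" (opt_ord o) 0 = row_law R (cur st) j o.
Proof.
move=> [_ sA sr sg _] sj r0.
have [] := column_law_spec n s; rewrite /= sj => H1 H2.
have qE (k : 'I_n) : (if nm s "At" k j == 1%N
     then rm s "g" (nm s "r" k 0 - 1) 0 / rm s "g" (nm s "r" k 0) 0 else 1)
   = col_ratio R (cur st) j k.
  rewrite sA sr eqb1 /col_ratio !sg ?rowsum_le //.
  by rewrite (leq_trans (leq_subr _ _)) ?rowsum_le.
have pE (i : 'I_n) : rm (exec n (column_law R) s) "p" i 0 = row_law R (cur st) j (Some i).
  rewrite H1 // sA sr eqb1 /row_law; case: ifP => B_ij //.
  rewrite !sg ?rowsum_le //; last exact: leq_ltn_trans (ltn_ord i).
  rewrite Mt_reduce //; congr (_ * _).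
  rewrite -(eq_bigr _ (fun k _ => qE k)).
  exact: (prod_skip (fun k => if nm s "At" k j == 1%N
     then rm s "g" (nm s "r" k 0 - 1) 0 / rm s "g" (nm s "r" k 0) 0 else 1)).
case=> [i|] /=; first exact: pE.
rewrite addn0 H2 /row_law; congr (1 - _); apply: eq_bigr => i _.
by rewrite -H1 // pE.
Qed.

(** A crude bound valid on every branch; the 100 absorbs tests, flag assignments and sequencing. *)
Definition col_cost : nat :=
  (cost_bound n (check_column R) + cost_bound n (column_law R) +
   cost_bound n (select_row R) + n + 100)%N.

(** The index [b] is arbitrary since [pi] is unconstrained once [accept] is false. *)
Lemma simulates_fail A (j : 'I_n) s s' st b :
  simulates A j s st -> nm s' "A" = nm s "A" -> nm s' "At" = nm s "At" ->
  nm s' "r" = nm s "r" -> rm s' "g" = rm s "g" -> nm s' "accept" 0 0 = 0%N ->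
  simulates A b s' (PassState (cur st) false (match_of st)).
Proof.
move=> [sI sA sr sg _] eA eAt er eg ea; split; rewrite ?eAt ?er ?eg //.
by move=> i k; rewrite eA.
Qed.

Lemma simulates_select A (j i : 'I_n) s s' st : cur st i j ->
  simulates A j s st -> nm s "j" 0 0 = j ->
  (forall y, ~~ has (String.eqb y) [:: "R"] -> nm s' y = nm s y) ->
  rm s' "g" = rm s "g" -> nm s' "R" 0 0 = i ->
  simulates A j.+1 (exec n (select_row R) s')
    (PassState (reduce (cur st) i j) (accept st)
       [ffun l => if l == j then Some i else match_of st l]).
Proof.
move=> B_ij [sI sA sr sg [sacc sm]] sj fn eg sR.
have [] := select_row_spec (n := n) (s := s').
- by rewrite sR.
- by rewrite fn // sj.
rewrite sR !fn // sj => H1 H2 H3.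
split=> [k l|k l|k|a an|].
- by rewrite nm_frame // fn.
- rewrite H1 // sA eqb1 mxE -!val_eqE /=.
  case: (eqVneq (k : nat) i) => [ki|ki] /=; first by case: eqP.
  by case: eqP => //= lj; case: (cur st k l).
- rewrite H2 // sr sA rowsum_reduce // -val_eqE /=.
  by case: ifP => // _; case: (cur st k j).
- by rewrite rm_frame // eg; exact: sg.
split=> [|acc l lj]; first by rewrite nm_frame // fn.
rewrite H3 /= ffunE -val_eqE /=.
case: (eqVneq (l : nat) j) => [_|lj']; first by rewrite valK.
by apply: sm => //; rewrite ltn_neqAle lj' -ltnS.
Qed.

Definition next_state st (j : 'I_n) (o : option 'I_n) : pass_state n :=
  if o is Some i then
    PassState (reduce (cur st) i j) (accept st)
      [ffun l => if l == j then Some i else match_of st l]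
  else PassState (cur st) false (match_of st).

Lemma columnE_next (j : 'I_n) (F : pass_state n -> \bar R) st :
  columnE j F st = if hopeless (cur st) j then F (next_state st j None)
    else draw 0 (row_law R (cur st) j) (F \o next_state st j).
Proof.
rewrite /columnE; case: ifP => // _; congr draw.
by apply/funext => -[i|].
Qed.

(** One column of the program against one column of the process, for time and probability at once.
    [h o] collects the cost and the memory after outcome [o]; they are constrained only where [o]
    has nonzero probability. *)
Lemma column_sim A b (j : 'I_n) s st F : simulates A j s st ->
  if hopeless (cur st) j then
    exists2 s', simulates A j.+1 s' (next_state st j None) &
    exists2 k, (k <= col_cost)%N &
      expect b n col_body F (nset s "j" 0 0 j) = (tick R b k + F s')%E
  else
    exists2 h : option 'I_n -> nat * memory R,
      (forall o, row_law R (cur st) j o != 0 ->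
        ((h o).1 <= col_cost)%N /\
        simulates A j.+1 (h o).2
        (next_state st j o)) &
    exists2 k, (k <= col_cost)%N &
      expect b n col_body F (nset s "j" 0 0 j) =
        (tick R b k + draw (if b then +oo else 0) (row_law R (cur st) j)
           (fun o => tick R b (h o).1 + F (h o).2))%E.
Proof.
move=> sim; set s1 := nset s "j" 0 0 j.
have s1j : nm s1 "j" 0 0 = j by [].
have sim1 : simulates A j s1 st by [].
rewrite /col_body expect_seq.
have [k1 k1b ->] := @expect_det R n b (check_column R) s1 (expect b n (If (BEq (nv "bad") (NC 1))
      (nset0 R "accept" (NC 0))
      (Seq (column_law R)
       (Seq (Draw "R" "p" (NAdd NSize (NC 1)))
       (If (BLt (nv "R") NSize)
         (select_row R)
         (nset0 R "accept" (NC 0)))))) F) isT.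
set s2 := exec n (check_column R) s1.
have s2j : nm s2 "j" 0 0 = j by rewrite /s2 nm_frame.
rewrite expect_if.
have -> : beval n (BEq (nv "bad") (NC 1)) s2 = hopeless (cur st) j.
  by rewrite /= (hopeless_check sim1 s1j) eqb1.
have sim2 : simulates A j s2 st.
  have [h1 h2 h3 h4 h5] := sim1; split.
  - by rewrite /s2 /input nm_frame.
  - by rewrite /s2 nm_frame.
  - by rewrite /s2 nm_frame.
  - by rewrite /s2 rm_frame.
  - by rewrite /s2 !nm_frame.
case: (boolP (hopeless _ _)) => hB.
  have [k2 k2b ->] := @expect_det R n b (nset0 R "accept" (NC 0)) s2 F isT.
  exists (exec n (nset0 R "accept" (NC 0)) s2).
    exact: (simulates_fail _ sim2).
  exists (1 + (k1 + (1 + 5 + k2)))%N; first by move: k1b k2b; rewrite /col_cost /=; lia.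
  by rewrite !addeA !tickD; congr (tick _ _ _ + _)%E; rewrite /=; lia.
rewrite expect_seq.
have [k2 k2b ->] := @expect_det R n b (column_law R) s2 (expect b n
       (Seq (Draw "R" "p" (NAdd NSize (NC 1)))
       (If (BLt (nv "R") NSize)
         (select_row R)
         (nset0 R "accept" (NC 0)))) F) isT.
set s3 := exec n (column_law R) s2.
have [r0 _] := hopelessPn hB.
have law := law_simulates sim2 s2j r0.
have s3j : nm s3 "j" 0 0 = j by rewrite /s3 nm_frame.
have sim3 : simulates A j s3 st.
  have [h1 h2 h3 h4 h5] := sim2; split.
  - by rewrite /s3 /input nm_frame.
  - by rewrite /s3 nm_frame.
  - by rewrite /s3 nm_frame.
  - by rewrite /s3 rm_frame.
  - have e1 : nm s3 "accept" = nm s2 "accept" by rewrite /s3 nm_frame.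
    have e2 : nm s3 "pi" = nm s2 "pi" by rewrite /s3 nm_frame.
    by rewrite e1 e2.
rewrite expect_seq.
set C := If _ _ _.
(* The 3 is the cost of evaluating the expression for [n + 1]; the draw itself is charged [n + 1]
   more. *)
rewrite -[expect b n (Draw _ _ _) _ _]/(tick R b (1 + 3 + (n + 1)) +
  draw (if b then +oo else 0) (fun k : 'I_(n + 1) => rm s3 "p" k 0)
    (fun k : 'I_(n + 1) => expect b n C F (nset s3 "R" 0 0 k)))%E.
rewrite (draw_bij _ _ _ opt_ord_bij).
have Ch : forall o : option 'I_n, exists km : nat * memory R,
  (row_law R (cur st) j o != 0 -> (km.1 <= col_cost)%N /\ simulates A j.+1 km.2
    (next_state st j o)) /\
  expect b n C F (nset s3 "R" 0 0 (opt_ord o)) = (tick R b km.1 + F km.2)%E.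
  move=> o; set s4 := nset s3 "R" 0 0 (opt_ord o).
  rewrite /C expect_if.
  have -> : beval n (BLt (nv "R") NSize) s4 = isSome o.
    by rewrite /= /upd /=; case: o {s4} => [i|] /=; rewrite ?ltn_ord // addn0 ltnn.
  case: o @s4 => [i|] s4 /=.
    have [k3 k3b ->] := @expect_det R n b (select_row R) s4 F isT.
    exists (1 + (1 + (1 + 1 + 1) + 1) + k3, exec n (select_row R) s4)%N.
    split; last by rewrite addeA tickD.
    move=> p0; split.
      by apply: leq_trans (leq_add (leqnn _) k3b) _; rewrite /col_cost; lia.
    apply: simulates_select sim3 s3j _ _ _ => //.
      by move: p0; case: ifP => //; rewrite eqxx.
    move=> y; rewrite /= orbF => /negPf yR; apply/funext => u; apply/funext => v.
    by rewrite /upd yR.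
  have [k3 k3b ->] := @expect_det R n b (nset0 R "accept" (NC 0)) s4 F isT.
  exists (1 + (1 + (1 + 1 + 1) + 1) + k3, exec n (nset0 R "accept" (NC 0)) s4)%N.
  split; last by rewrite addeA tickD.
  move=> _; split; first by move: k3b; rewrite /col_cost /=; lia.
  exact: (simulates_fail _ sim3).
have [h hP] := choice Ch.
exists h; first by move=> o; have [] := hP o.
exists (1 + (k1 + (1 + 5 + (1 + (k2 + (1 + (1 + 3 + (n + 1))))))))%N.
  by move: k1b k2b; rewrite /col_cost; lia.
rewrite !addeA !tickD; congr (tick _ _ _ + _)%E; first by rewrite /=; lia.
apply: eq_draw => [t|t _] /=; first exact: law.
by have [_ ->] := hP t.
Qed.

Lemma outcome_simulates A s st : simulates A n s st -> outcome n s = pass_outcome st.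
Proof.
move=> [_ _ _ _ [sacc sm]]; rewrite /outcome /pass_outcome sacc eqb1.
case: ifP => // acc; congr Some; apply/ffunP => l.
by rewrite ffunE sm.
Qed.

Lemma columns_sim A (f : memory R -> \bar R) (F : pass_state n -> \bar R) :
  (forall s st, simulates A n s st -> f s = F st) ->
  forall (l : seq 'I_n) j s st, map val l = iota j (size l) ->
  (j + size l)%N = n -> simulates A j s st ->
  foldr (fun i X s' => (tick R false 1 + expect false n col_body X (nset s' "j" 0 0 i))%E)
    f (iota j (size l)) s = foldr (@columnE R n) F l st.
Proof.
move=> fF; elim=> [|i l IH] j s st /= El jn sim.
  by apply: fF; rewrite -jn addn0.
case: El => ij El; rewrite add0e.
have sim' : simulates A i s st by rewrite ij.
have jn' : (i.+1 + size l)%N = n by rewrite ij addSnnS.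
rewrite -ij in El *.
set X := foldr _ f _; have := column_sim false X sim'; rewrite columnE_next.
case: ifP => hB.
  move=> [s' sim2 [k _ ->]]; rewrite add0e.
  exact: IH.
move=> [h hP [k _ ->]]; rewrite add0e.
apply: eq_draw => // o po; rewrite add0e.
have [_ sim2] := hP o po.
exact: IH.
Qed.

(** Each column costs one operation for the loop, at most [col_cost] up to the draw and at most
    [col_cost] after it. *)
Lemma columns_sim_timed A (f : memory R -> \bar R) (F : pass_state n -> \bar R) :
  (forall st, 0 <= F st)%E ->
  (forall s st, simulates A n s st -> (f s <= F st)%E) ->
  forall (l : seq 'I_n) j s st, map val l = iota j (size l) ->
  (j + size l)%N = n -> simulates A j s st ->
  (foldr (fun i X s' => tick R true 1 + expect true n col_body X (nset s' "j" 0 0 i))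
    f (iota j (size l)) s <=
  (size l * (1 + 2 * col_cost))%:R%:E + foldr (@columnE R n) F l st)%E.
Proof.
move=> F0 fF; elim=> [|i l IH] j s st /= El jn sim.
  by rewrite mul0n add0e; apply: fF; rewrite -jn addn0.
case: El => ij El.
have sim' : simulates A i s st by rewrite ij.
have jn' : (i.+1 + size l)%N = n by rewrite ij addSnnS.
rewrite -ij in El *.
set X := foldr _ f _; have := column_sim true X sim'.
have -> : ((size l).+1 * (1 + 2 * col_cost))%:R%:E =
   ((1 + col_cost + (col_cost + size l * (1 + 2 * col_cost)))%:R : R)%:E.
  by congr (_%:R)%:E; rewrite mulSn; lia.
rewrite columnE_next; case: (boolP (hopeless _ _)) => hB.
  move=> [s' sim2 [k kb ->]]; rewrite /tick addeA -EFinD -natrD.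
  apply: le_trans (leeD2l _ (IH _ _ _ El jn' sim2)) _.
  rewrite addeA -EFinD -natrD; apply: leeD2r.
  rewrite lee_fin ler_nat; lia.
move=> [h hP [k kb ->]]; rewrite /tick addeA -EFinD -natrD.
set Y := foldr (@columnE R n) F l.
apply: (@le_trans _ _ ((1 + k)%:R%:E + ((col_cost + size l * (1 + 2 * col_cost))%:R%:E +
   draw 0 (row_law R (cur st) i) (Y \o next_state st i)))%E).
  apply: leeD2l; apply: draw_le => // [||o po]; first exact: row_law_dist.
    by move=> o; apply: columns_ge0.
  have [hb sim2] := hP o po.
  apply: le_trans (leeD2l _ (IH _ _ _ El jn' sim2)) _.
  rewrite addeA -EFinD -natrD.
  apply: leeD2r; rewrite lee_fin ler_nat; lia.
rewrite addeA -EFinD -natrD; apply: leeD2r.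
rewrite lee_fin ler_nat; lia.
Qed.

Definition pass_cost : nat :=
  (1 + cost_bound n (init_pass R) + 2 + n * (1 + 2 * col_cost))%N.

Lemma init_simulates (A : 'M[bool]_n) s : input A s ->
  simulates A 0 (exec n (init_pass R) s) (PassState A true [ffun=> None]).
Proof.
move=> sA; have [H1 H2 H3 H4] := init_pass_spec n s; split=> //=.
- by move=> i k; rewrite nm_frame.
- by move=> i k; rewrite H2.
- by move=> i; rewrite H3 //; apply: eq_bigr => k _.
Qed.

(** The hypothesis on [f] is restricted to memories that still hold the input, since this is what
    the next iteration of [Repeat] relies on. *)
Lemma pass_sim (A : 'M[bool]_n) s (f : memory R -> \bar R) F : input A s ->
  (forall s', input A s' -> f s' = F (outcome n s')) ->
  expect false n (pass R) f s = passE A F.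
Proof.
move=> sA fF; rewrite /pass expect_seq.
have [k _ ->] := @expect_det R n false (init_pass R) s
  (expect false n (For "j" NSize col_body) f) isT.
rewrite !add0e -[expect _ _ (For _ _ _) _ _]/(tick R false 2 + _)%E add0e.
have := @columns_sim A f (F \o @pass_outcome n) _ (enum 'I_n) 0 _ _ _ _ (init_simulates sA).
rewrite size_enum_ord add0n val_enum_ord; apply=> //.
move=> s' st sim; rewrite fF ?(outcome_simulates sim) //.
by case: sim.
Qed.

Lemma pass_sim_timed (A : 'M[bool]_n) s (f : memory R -> \bar R) F : input A s ->
  (forall o, 0 <= F o)%E ->
  (forall s', input A s' -> (f s' <= F (outcome n s'))%E) ->
  (expect true n (pass R) f s <= pass_cost%:R%:E + passE A F)%E.
Proof.
move=> sA F0 fF; rewrite /pass expect_seq.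
have [k kb ->] := @expect_det R n true (init_pass R) s
  (expect true n (For "j" NSize col_body) f) isT.
rewrite -[expect _ _ (For _ _ _) _ _]/(tick R true 2 + _)%E.
have := @columns_sim_timed A f (F \o @pass_outcome n) _ _ (enum 'I_n) 0 _ _ _ _ (init_simulates sA).
rewrite size_enum_ord add0n val_enum_ord => H.
rewrite /tick !addeA -!EFinD -!natrD.
apply: le_trans (leeD2l _ (H _ _ _ _)) _ => //.
- by move=> st; exact: F0.
- move=> s' st sim; rewrite /= -(outcome_simulates sim); apply: fF.
  by case: sim.
rewrite addeA -EFinD -natrD /passE; apply: leeD2r.
by rewrite lee_fin ler_nat /pass_cost; lia.
Qed.

Lemma passE_ge0 (A : 'M[bool]_n) F : (forall o, 0 <= F o)%E -> (0 <= @passE R n A F)%E.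
Proof. by move=> F0; apply: columns_ge0 => st; exact: F0. Qed.

End Simulation.

(** * Repeating the pass until acceptance *)

Section Generate.
Variable R : realType.

Lemma ereal_sup_geometric (c r : R) : 0 <= c -> 0 <= r -> r < 1 ->
  ereal_sup (range (fun k => (c * (1 - r ^+ k))%:E)) = c%:E.
Proof.
move=> c0 r0 r1; set u := fun k => _.
have nd : nondecreasing_seq u.
  apply/nondecreasing_seqP => k; rewrite lee_fin ler_wpM2l // lerB //.
  by rewrite exprS ler_piMl ?exprn_ge0 // ltW.
apply: (cvg_unique _ (ereal_nondecreasing_cvgn nd)) => //.
apply: cvg_EFin; first by near=> k.
rewrite (_ : fine \o u = fun k => c * (1 - r ^+ k)) //.
have : ((fun k => c * (1 - r ^+ k)) @ \oo --> c * (1 - 0))%classic.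
  apply: cvgMr; apply: cvgB; first exact: cvg_cst.
  by apply: cvg_expr; rewrite ger0_norm.
by rewrite subr0 mulr1.
Unshelve. all: by end_near. Qed.

Local Arguments expect : simpl never.
Section Matrix.
Variables (n : nat) (A : 'M[bool]_n).
Let PM := perfect_matchings A.
Let M := Mt R A.
Hypothesis PM0 : (0 < #|PM|)%N.

Lemma Mt_gt0_matching : 0 < M.
Proof.
have /card_gt0P[pi] := PM0; rewrite inE => /forallP Api.
apply: Mt_gt0 => k; apply: (@rowsum_gt0 _ _ _ (pi^-1%g k)).
by have := Api (pi^-1%g k); rewrite permKV.
Qed.

(** The probability that a pass fails is [1 - #|PM| / M], and it cannot be negative. *)
Lemma matchings_le_Mt : #|PM|%:R <= M.
Proof.
pose G (o : option {ffun 'I_n -> option 'I_n}) : R := (o == None)%:R.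
have : (0 <= @passE R n A (fun o => (G o)%:E))%E.
  by apply: passE_ge0 => o; rewrite lee_fin.
rewrite passE_value lee_fin /G /= sub0r sumr_const -/PM mulNrn mulNr subr_ge0.
by rewrite ler_pdivrMr ?Mt_gt0_matching // mul1r.
Qed.

Lemma prob_generate (s : memory R) (Q : {ffun 'I_n -> option 'I_n} -> bool) :
  input A s -> prob n (generate R) (fun s' => Q (output n s')) s =
  ((\sum_(pi in PM) (Q [ffun j => Some (pi j)])%:R) / #|PM|%:R)%:E.
Proof.
move=> sA; set N := \sum_(pi in PM) _.
have M0 := Mt_gt0_matching.
have P0 : 0 < #|PM|%:R :> R by rewrite ltr0n.
(* [r] is the probability that a pass fails, and [y k] that of an accepted output satisfying [Q]
   within [k] passes, the sum of a geometric series. *)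
pose r := 1 - #|PM|%:R / M.
pose y k := N / #|PM|%:R * (1 - r ^+ k).
have N0 : 0 <= N by apply: sumr_ge0.
rewrite /prob /generate.
pose Phi (X : memory R -> \bar R) s1 :=
  expect false n (pass R) (fun s' => (0 + if nm s' "accept"%string 0 0 == 1%N then
     if Q (output n s') then 1 else 0 else X s')%E) s1.
rewrite -[LHS]/(ereal_sup (range (fun k => iter k Phi (cst 0%E) s))).
have H k : forall s1, input A s1 -> iter k Phi (cst 0%E) s1 = (y k)%:E.
  elim: k => [|k IH] s1 s1A; first by rewrite /y expr0 subrr mulr0.
  pose G o : R := if o is Some m then (Q m)%:R else y k.
  rewrite iterS {1}/Phi (@pass_sim _ _ A _ _ (fun o => (G o)%:E)) //.
    rewrite passE_value /G sumrB sumr_const -/PM -/N -/M.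
    congr _%:E; rewrite -mulr_natl /y exprS.
    by rewrite /r; field; rewrite !gt_eqF.
  move=> s' s'A; rewrite add0e /outcome.
  by rewrite /G; case: eqP => _; [case: (Q _)|exact: IH].
rewrite (_ : (fun k => _) = fun k => (y k)%:E); last by apply/funext => k; exact: H.
apply: ereal_sup_geometric; first by rewrite divr_ge0.
  by rewrite subr_ge0 ler_pdivrMr // mul1r matchings_le_Mt.
by rewrite ltrBlDr ltrDl divr_gt0.
Qed.

(** The bound [t] is the fixed point of [t = T + (1 - #|PM| / M) t], so by induction no iterate
    exceeds it. The 6 in [T] is the cost of the test of [Repeat]. *)
Lemma expected_time_generate (s : memory R) : input A s ->
  (expected_time n (generate R) s <=
    ((pass_cost R n + 6)%:R * M / #|PM|%:R)%:E)%E.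
Proof.
move=> sA; set T := (_ + 6)%:R; set t := _ / _.
have M0 := Mt_gt0_matching.
have P0 : 0 < #|PM|%:R :> R by rewrite ltr0n.
have t0 : 0 <= t by rewrite divr_ge0 // mulr_ge0 // ltW.
rewrite /expected_time /generate.
pose Phi (X : memory R -> \bar R) s1 :=
  expect true n (pass R) (fun s' => (6%:R%:E + if nm s' "accept"%string 0 0 == 1%N then
     0 else X s')%E) s1.
rewrite -[leLHS]/(ereal_sup (range (fun k => iter k Phi (cst 0%E) s))).
have H k : forall s1, input A s1 -> (iter k Phi (cst 0%E) s1 <= t%:E)%E.
  elim: k => [|k IH] s1 s1A; first by rewrite lee_fin.
  pose G (o : option {ffun 'I_n -> option 'I_n}) : R :=
    if o is Some _ then 6%:R else 6%:R + t.
  rewrite iterS {1}/Phi.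
  apply: le_trans (@pass_sim_timed _ _ A _ _ (fun o => (G o)%:E) s1A _ _) _.
  - by case=> [m|]; rewrite lee_fin /G // addr_ge0.
  - move=> s' s'A; rewrite /outcome; case: eqP => _; first by rewrite adde0.
    by have -> : (G None)%:E = (6%:R%:E + t%:E)%E by []; apply: leeD2l; exact: IH.
  rewrite passE_value /G opprD addrA subrr sub0r sumr_const -/PM -/M.
  rewrite -EFinD lee_fin le_eqVlt; apply/orP; left; apply/eqP.
  rewrite /t /T -mulr_natl natrD.
  by field; rewrite !gt_eqF.
by apply: ub_ereal_sup => _ [k _ <-]; exact: H.
Qed.

End Matrix.

Lemma pass_cost_le :
  exists2 K : nat, (0 < K)%N &
  forall n, (0 < n)%N -> (pass_cost R n + 6 <= K * n ^ 2)%N.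
Proof.
(* A generous bound on the sum of the coefficients of this quadratic polynomial in [n]. *)
exists 2000%N => // n n0; rewrite /pass_cost /col_cost /=.
have n2 : (n <= n * n)%N by rewrite leq_pmulr.
rewrite -mulnn; lia.
Qed.

Lemma card_perfect_matchings_ge n D (A : 'M[bool]_n) : (0 < D)%N -> regular D A ->
  (D ^ n * n`! <= n ^ n * #|perfect_matchings A|)%N.
Proof.
move=> D0 [rD cD]; apply: (@card_perm_matrix_ge n D (fun i j => A i j)) => //.
Qed.

(** The bound on the permanent also yields the existence of a matching, in place of Hall's
    theorem. *)
Lemma regular_has_matching n D (A : 'M[bool]_n) : (0 < D)%N -> regular D A ->
  (0 < #|perfect_matchings A|)%N.
Proof.
move=> D0 rA; have := card_perfect_matchings_ge D0 rA.
by rewrite lt0n; apply: contraTneq => ->;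
  rewrite muln0 -ltnNge muln_gt0 expn_gt0 D0 fact_gt0.
Qed.

Lemma expected_time_le : exists2 C : R, 0 < C &
  forall n D (A : 'M[bool]_n) (s : memory R),
  (0 < n)%N -> (0 < D)%N -> regular D A -> input A s ->
  (expected_time n (generate R) s <=
     (C * (n%:R `^ (3 / 2) * D%:R `^ (1 / 2 * (n%:R / D%:R))
              * (53 / 10) `^ (n%:R / D%:R)))%:E)%E.
Proof.
have [K K0 cost_le] := pass_cost_le; exists K%:R; first by rewrite ltr0n.
move=> n D A s n0 D0 rA sA; have PM0 := regular_has_matching D0 rA.
have P0 : 0 < #|perfect_matchings A|%:R :> R by rewrite ltr0n.
have M0 := Mt_gt0_matching PM0.
apply: le_trans (expected_time_generate PM0 sA) _; rewrite lee_fin.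
(* Separates the cost of a pass from the expected number of passes, which is then bounded through
   the permanent. *)
apply: (@le_trans _ _ ((K%:R * n%:R ^+ 2) *
    ((g R D / expR 1) ^+ n * n%:R ^+ n / (D%:R ^+ n * n`!%:R)))).
  rewrite -mulrA; apply: ler_pM => //.
  - by rewrite divr_ge0 // ltW.
  - by rewrite -natrX -natrM ler_nat cost_le.
  have -> : Mt R A = (g R D / expR 1) ^+ n.
    rewrite /Mt -[n in RHS]card_ord -prodr_const.
    by apply: eq_bigr => i _; have [-> _] := rA.
  have DF : 0 < D%:R ^+ n * n`!%:R :> R.
    by rewrite mulr_gt0 ?exprn_gt0 // ltr0n // fact_gt0.
  rewrite -mulrA ler_wpM2l ?exprn_ge0 ?divr_ge0 ?g_ge0 ?expR_ge0 //.
  rewrite ler_pdivlMr // mulrC ler_pdivrMr //.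
  by rewrite -!natrX -!natrM ler_nat card_perfect_matchings_ge.
rewrite -mulrA ler_pM2l ?ltr0n //.
exact: passes_le.
Qed.

End Generate.

Theorem theorem1 (R : realType) :
  (forall (n : nat) (A : 'M[bool]_n) (s : memory R),
     input A s -> pass_implemented A s) /\
  (forall (n D : nat) (A : 'M[bool]_n) (s : memory R),
     (0 < n)%N -> (0 < D)%N -> regular D A -> input A s ->
     uniform_output A s) /\
  (exists C : R, 0 < C /\
     forall (n D : nat) (A : 'M[bool]_n) (s : memory R),
       (0 < n)%N -> (0 < D)%N -> regular D A -> input A s ->
       (expected_time n (generate R) s <=
          (C * (n%:R `^ (3 / 2)
                * D%:R `^ (1 / 2 * (n%:R / D%:R))
                * (53 / 10) `^ (n%:R / D%:R)))%:E)%E) /\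
  (forall gamma : R, 0 < gamma ->
     exists C : R, 0 < C /\
     forall (n D : nat) (A : 'M[bool]_n) (s : memory R),
       (0 < n)%N -> (0 < D)%N -> regular D A -> input A s ->
       D%:R = gamma * n%:R ->
       (expected_time n (generate R) s <=
          (C * n%:R `^ (3 / 2 + 1 / 2 / gamma))%:E)%E).
Proof.
split=> [n A s sA F F0|]; first by apply: (pass_sim sA).
split=> [n D A s n0 D0 rA sA|].
  have PM0 := regular_has_matching D0 rA.
  have P0 : 0 < #|perfect_matchings A|%:R :> R by rewrite ltr0n.
  split=> [pi pi_in|].
    rewrite /outputs (prob_generate PM0 (fun m => m == [ffun j => Some (pi j)]) sA).
    congr _%:E; rewrite (bigD1 pi) //= eqxx big1 ?addr0 ?mul1r // => sg /andP[_ sgpi].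
    case: eqP => // /ffunP E; case/eqP: sgpi; apply/permP => j.
    by have := E j; rewrite !ffunE => -[].
  rewrite (prob_generate PM0 (fun m => [exists pi in perfect_matchings A,
    m == [ffun j => Some (pi j)]]) sA).
  rewrite (eq_bigr (fun=> 1)) => [|pi pi_in].
    by rewrite sumr_const divff // gt_eqF.
  by rewrite (_ : [exists _ in _, _]) //; apply/existsP; exists pi; rewrite pi_in eqxx.
have [K K0 time_le] := expected_time_le R.
split; first by exists K.
move=> gamma gamma0.
(* As [n / D = 1 / gamma], the last factor of the general bound is constant, and the power of
   [D = gamma n] splits into a constant and a power of [n]. *)
pose C : R := K * (gamma `^ (1 / 2 / gamma) * (53 / 10) `^ gamma^-1).
exists C; split.
  by rewrite /C !mulr_gt0 ?powR_gt0 //; lra.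
move=> n D A s n0 D0 rA sA Dn.
have n0R : 0 < n%:R :> R by rewrite ltr0n.
apply: le_trans (time_le _ _ _ _ n0 D0 rA sA) _.
have -> : n%:R / D%:R = gamma^-1 :> R by rewrite Dn; field; rewrite !gt_eqF.
rewrite lee_fin Dn powRM ?(ltW gamma0) // [n%:R `^ (_ + _)]powRD; last first.
  by apply/implyP => _; rewrite gt_eqF.
by rewrite le_eqVlt; apply/orP; left; apply/eqP; rewrite /C; ring.
Qed.
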